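(* Let $(X,T)$ be a topological dynamical system, let $\mathcal{E}\colon \mathcal{M}(X)\to\mathbb{R}$ be an energy, and let $\mathcal{U}$ be a finite open cover of $X$. Suppose that $(T,\mathcal{E};\mathcal{U})$ has an abundance of ergodic measures. Then $$P(T,\mathcal{E};\mathcal{U})=\underline{P}(T,\mathcal{E};\mathcal{U})=\sup_{\mu\in\mathcal{M}(X,T)}\left\{h_\mu(T,\mathcal{U})+\mathcal{E}(\mu)\right\}.$$
   Context: A topological dynamical system (TDS) is a pair $(X,T)$ with $X$ a compact metric space and $T:X\to X$ a continuous surjection. $\mathcal{M}(X)$ is the set of Borel probability measures on $X$ with the weak-star topology; $\mathcal{M}(X,T)$ is the set of $T$-invariant ones and $\mathcal{M}^e(X,T)$ the set of ergodic $T$-invariant ones. An energy is a weak-star continuous function $\mathcal{E}\colon\mathcal{M}(X)\to\mathbb{R}$. A cover of $X$ is a finite collection of Borel subsets with union $X$; a partition is a cover with pairwise disjoint elements. $\mathcal{C}_X,\mathcal{P}_X,\mathcal{C}_X^o$ denote the sets of covers, partitions, and open covers (covers consisting of open sets). $\mathcal{V}\succeq\mathcal{W}$ means each element of $\mathcal{V}$ is contained in some element of $\mathcal{W}$. $\mathcal{U}\vee\mathcal{V}=\{U\cap V: U\in\mathcal{U},V\in\mathcal{V}\}$ and $\mathcal{U}_0^{n-1}=\bigvee_{i=0}^{n-1}T^{-i}\mathcal{U}$. For $x\in X$, $n\ge1$, let $\triangle_x^n=\frac1n\sum_{i=0}^{n-1}\delta_{T^ix}$. For $\mathcal{U}\in\mathcal{C}_X^o$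 let $$p_n(T,\mathcal{E};\mathcal{U})=\inf\Big\{\sum_{V\in\mathcal{V}}\sup_{x\in V}e^{n\mathcal{E}(\triangle_x^n)}:\mathcal{V}\in\mathcal{C}_X,\ \mathcal{V}\succeq\mathcal{U}_0^{n-1}\Big\},$$ $$P(T,\mathcal{E};\mathcal{U})=\limsup_{n\to\infty}\tfrac1n\log p_n(T,\mathcal{E};\mathcal{U}),\qquad \underline{P}(T,\mathcal{E};\mathcal{U})=\liminf_{n\to\infty}\tfrac1n\log p_n(T,\mathcal{E};\mathcal{U}).$$ For a partition $\alpha$, $H_\mu(\alpha)=\sum_{A\in\alpha}-\mu(A)\log\mu(A)$. For a cover $\mathcal{U}$, $H_\mu(\mathcal{U})=\inf\{H_\mu(\alpha):\alpha\in\mathcal{P}_X,\ \alpha\succeq\mathcal{U}\}$, and for $\mu\in\mathcal{M}(X,T)$, $h_\mu(T,\mathcal{U})=\lim_{n\to\infty}\frac1nH_\mu(\mathcal{U}_0^{n-1})$ (the limit exists). $(T,\mathcal{E};\mathcal{U})$ has an abundance of ergodic measures if for every $\mu\in\mathcal{M}(X,T)$ and $\varepsilon>0$ there is $\nu\in\mathcal{M}^e(X,T)$ with $h_\nu(T,\mathcal{U})+\mathcal{E}(\nu)>h_\mu(T,\mathcal{U})+\mathcal{E}(\mu)-\varepsilon$. *)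

(* Defs.v *)
From HB Require Import structures.
From mathcomp Require Import all_boot all_order all_algebra.
From mathcomp Require Import all_classical all_reals all_analysis.

Set Implicit Arguments.
Unset Strict Implicit.
Unset Printing Implicit Defensive.

Import Order.TTheory GRing.Theory Num.Theory.
Import numFieldNormedType.Exports.

Local Open Scope classical_set_scope.
Local Open Scope ring_scope.

(* Measurable types of the library are pointed, so the phase space must be a
   nonempty metric space; nothing depends on the chosen point. *)
#[short(type="pointedMetricType")]
HB.structure Definition PointedMetric (R : numDomainType) :=
  {X of Metric R X & Pointed X}.

Notation borelType X := (g_sigma_algebraType (@open X)).

Section BorelProbabilities.
Context {R : realType} {X : pointedMetricType R}.

(* The weak-star topology on Borel probability measures is the coarsest one
   making every mu |-> \int f dmu, with f continuous, continuous. *)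
Definition weak_star : topologicalType :=
  initial_topology (fun mu : probability (borelType X) R =>
    (fun f : continuousType X R => \int[mu]_(x in [set: X]) f x)
      : {ptws continuousType X R -> R}).

(* Library measures take unspecified values on non-measurable sets; as R is
   Hausdorff, an energy cannot see these values. *)
Definition energy (E : probability (borelType X) R -> R) : Prop :=
  continuous (E : weak_star -> R).

Definition invariant_prob (T : X -> X) : set (probability (borelType X) R) :=
  [set mu | forall A : set (borelType X),
     measurable A -> mu (T @^-1` A) = mu A].

Definition ergodic_prob (T : X -> X) : set (probability (borelType X) R) :=
  [set mu | invariant_prob T mu /\
     forall A : set (borelType X), measurable A -> T @^-1` A = A ->
       mu A = 0%E \/ mu A = 1%E].

End BorelProbabilities.

Section EmpiricalMeasure.
Context {R : realType} {X : pointedMetricType R}.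
Variables (T : X -> X) (n : nat) (x : X).

(* (1 / (n + 1)) * \sum_(0 <= i <= n) \d_(T^i x): indices are shifted by one
   so that this is a probability measure for all n. *)
Definition empirical : set (borelType X) -> \bar R :=
  mscale (n.+1%:R^-1)%:nng
    (msum (fun i => \d_(iter i T x : borelType X)) n.+1).

HB.instance Definition _ := Measure.on empirical.

Lemma empirical_setT : empirical setT = 1%E.
Proof.
rewrite /empirical /mscale /= /msum.
rewrite (eq_bigr (fun=> 1%E)) => [|i _]; last exact: diracT.
by rewrite sumEFin sumr_const card_ord -EFinM mulVf.
Qed.

HB.instance Definition _ :=
  Measure_isProbability.Build _ _ _ empirical empirical_setT.

End EmpiricalMeasure.

Section CoverOperations.
Context {X : Type}.
Implicit Types (C D : set (set X)) (T : X -> X).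

Definition finer C D : Prop :=
  forall V, C V -> exists2 W, D W & V `<=` W.

Definition cover_join C D : set (set X) :=
  [set V `&` W | V in C & W in D].

Definition cover_preimage (f : X -> X) C : set (set X) :=
  [set f @^-1` V | V in C].

(* U_0^(n-1), the join of T^(-i) U for 0 <= i < n *)
Definition iter_cover T C (n : nat) : set (set X) :=
  \big[cover_join/[set [set: X]]]_(i < n) cover_preimage (iter i T) C.

End CoverOperations.

Section Covers.
Context {R : realType} {X : pointedMetricType R}.
Implicit Types C : set (set X).

Definition is_cover C : Prop :=
  [/\ finite_set C,
      (forall V, C V -> measurable (V : set (borelType X))) &
      \bigcup_(V in C) V = [set: X]].

Definition is_partition C : Prop := is_cover C /\ trivIset C id.

Definition is_open_cover C : Prop := is_cover C /\ forall V, C V -> open V.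

End Covers.

Section Pressure.
Context {R : realType} {X : pointedMetricType R}.
Variables (T : X -> X) (E : probability (borelType X) R -> R).
Variable U : set (set X).

(* p_(n+1)(T, E; U).  The real supremum of the empty set is 0, so an empty
   element of a cover contributes 0 to the sum. *)
Definition pressure_sum (n : nat) : R :=
  inf [set \sum_(V \in C)
             sup [set expR (n.+1%:R * E (empirical T n x)) | x in V]
      | C in [set C | is_cover C /\ finer C (iter_cover T U n.+1)]].

Definition pressure : \bar R :=
  limn_esup (fun n => (n.+1%:R^-1)%:E * lne (pressure_sum n)%:E)%E.

Definition lower_pressure : \bar R :=
  limn_einf (fun n => (n.+1%:R^-1)%:E * lne (pressure_sum n)%:E)%E.

End Pressure.

Section Entropy.
Context {R : realType} {X : pointedMetricType R}.
Implicit Types (mu nu : probability (borelType X) R).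

Definition partition_entropy mu (alpha : set (set X)) : R :=
  \sum_(A \in alpha) - (fine (mu A) * ln (fine (mu A))).

Definition cover_entropy mu (U : set (set X)) : R :=
  inf [set partition_entropy mu alpha
      | alpha in [set alpha | is_partition alpha /\ finer alpha U]].

Definition entropy (T : X -> X) (U : set (set X)) mu : R :=
  limn (fun n => n%:R^-1 * cover_entropy mu (iter_cover T U n)).

Definition ergodic_abundance (T : X -> X)
    (E : probability (borelType X) R -> R) (U : set (set X)) : Prop :=
  forall mu, invariant_prob T mu -> forall eps : R, 0 < eps ->
    exists2 nu, ergodic_prob T nu &
      entropy T U nu + E nu > entropy T U mu + E mu - eps.

End Entropy.

(* Main.v *)
(** Upper bound.  For each [n], pricing the points of a greedy cover yields
    weights whose mass on every element of [U_0^(n-1)] is at most [1 + O(n)]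
    divided by the number of sets used.  The finitely supported probability
    [sigma] so obtained satisfies [H_sigma(U_0^(n-1)) >= log (number of sets) -
    O(log n)], simultaneously for all finer partitions, so that no
    zero-dimensional extension of [(X, T)] is needed.  Cutting orbits into
    blocks and averaging [sigma] along them transfers this bound to
    [(1/N) H(U_0^(N-1))] for every [N], and a weak-star cluster point is an
    invariant measure which keeps it, because entropy of an open cover is upper
    semicontinuous.  As the energy is not affine, all this is done separately
    on finitely many classes of points whose empirical measures lie in a common
    small convex set.

    Lower bound.  If [nu] is ergodic, empirical measures are weak-star close to
    [nu] outside a set of small measure (by Garsia's maximal inequality), and
    Gibbs' inequality bounds [H_nu(U_0^(n-1))] by the logarithm of the number
    of elements of a cover which meet the good set, plus [o(n)].

    Weak-star compactness is obtained from limits along ultrafilters, which are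
    finitely additive on closed sets, by Caratheodory's construction. *)

Require Import Defs.
From HB Require Import structures.
From mathcomp Require Import all_boot all_order all_algebra.
From mathcomp Require Import all_classical all_reals all_analysis.
From mathcomp Require Import measurable_realfun.
From mathcomp Require Import ring lra zify.

Set Implicit Arguments.
Unset Strict Implicit.
Unset Printing Implicit Defensive.

Import Order.TTheory GRing.Theory Num.Theory.
Import numFieldNormedType.Exports.

Local Open Scope classical_set_scope.
Local Open Scope ring_scope.

(** * Gibbs inequality, Fekete lemma and greedy covers *)

(** Cover entropy is an infimum over finer partitions, so a lower bound for it must hold for all of
    them at once; this is why the upper bound asks for a measure that is small on every cylinder
    rather than for separated points. Finding one is the linear program dual to fractional covering,
    and greedy covering loses against it only a harmonic number. A point matters only through the
    letters allowed at each of the [n] times, which leaves at most [2^(d n)] types; the loss is thus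
    at most [1 + n d ln 2], whose logarithm is negligible against [n].

    The measure so obtained is not invariant, hence entropy inequalities are stated for
    pushforwards. The number of energy classes depends on the tolerance but not on [n], so keeping
    only the best class costs a bounded additive term in the logarithm. Abundance is what lets the
    lower bound, available for ergodic measures, reach all invariant ones: for an energy that is not
    affine, the ergodic decomposition does not give this. *)

Section Gibbs.
Context {R : realType}.
Implicit Types p q : R.

Definition ent_fun p : R := - (p * ln p).

(** This is [ln t <= t - 1] at [t = q / p]. The right-hand side is the tangent line of [ent_fun] at
    [q]; keeping [q - p] pointwise lets the same inequality serve for upper continuity, for
    concavity and, after summation, for the usual Gibbs inequality. The last hypothesis excludes the
    default value of [ln] at [0]. *)
Lemma gibbs p q : 0 <= p -> 0 <= q -> (q = 0 -> p = 0) ->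
  ent_fun p <= - (p * ln q) + q - p.
Proof.
rewrite /ent_fun => p0 q0 qp0.
have [->|pn0] := eqVneq p 0; first by rewrite !mul0r !oppr0 add0r addr0.
have pp : 0 < p by rewrite lt_neqAle eq_sym pn0.
have qp : 0 < q.
  by rewrite lt_neqAle q0 andbT eq_sym; apply: contra_neq pn0.
have := expR_ge1Dx (ln (q / p)).
rewrite lnK ?posrE ?divr_gt0// ln_div// => h.
have : p * (1 + (ln q - ln p)) <= p * (q / p) by rewrite ler_wpM2l.
rewrite mulrCA divff// mulr1; lra.
Qed.

Lemma ent_fun_upper_continuous p (e : R) : 0 <= p -> 0 < e ->
  exists2 d : R, 0 < d & forall q, 0 <= q -> `|q - p| <= d -> ent_fun q <= ent_fun p + e.
Proof.
(* The tangent line is taken slightly to the right of [p], so that it exists also for [p = 0]; the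
   shift costs [e / 2]. *)
move=> p0 e0; pose r := p + e / 2.
have r0 : 0 < r by rewrite /r; lra.
have A0 : 0 <= `|ln r| by [].
exists (e / 2 / (`|ln r| + 1)) => [|q q0 qp]; first by rewrite !divr_gt0//; lra.
have rq : r = 0 -> q = 0 by move=> r_eq; move: r0; rewrite r_eq ltxx.
have h := @gibbs q r q0 (ltW r0) rq.
have pr : p * ln p <= p * ln r.
  have [->|pn0] := eqVneq p 0; first by rewrite !mul0r.
  have pp : 0 < p by rewrite lt_neqAle eq_sym pn0.
  by rewrite ler_wpM2l// ler_ln ?posrE// /r; lra.
have h3 : `|q - p| * (`|ln r| + 1) <= e / 2.
  by rewrite -ler_pdivlMr//; lra.
have h1 : - ((q - p) * ln r) <= `|q - p| * `|ln r|.
  by rewrite -normrM (le_trans (ler_norm _))// normrN.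
have h2 : - (q - p) <= `|q - p| by rewrite -normrN ler_norm.
have rE : r = p + e / 2 by [].
clearbody r; move: h h3; rewrite /ent_fun mulrDr mulr1 => h h3.
have : q * ln r = (q - p) * ln r + p * ln r by ring.
lra.
Qed.

Lemma ent_fun_ge0 p : 0 <= p <= 1 -> 0 <= ent_fun p.
Proof.
move=> /andP[p0 p1]; rewrite /ent_fun oppr_ge0 mulr_ge0_le0//.
exact: ln_le0.
Qed.

End Gibbs.

Section Fekete.
Context {R : realType}.

Lemma fekete (a : nat -> R) : (forall n, 0 <= a n) ->
  (forall n m, a (n + m)%N <= a n + a m) ->
  cvgn (fun n => n%:R^-1 * a n).
Proof.
move=> a0 sub.
(* The infimum starts at [1], since the term of index [0] is [0] by convention. *)
pose S := [set n.+1%:R^-1 * a n.+1 | n in [set: nat]].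
have Slb : has_lbound S.
  by exists 0 => _ [n _ <-]; rewrite mulr_ge0// invr_ge0.
have S0 : S !=set0 by exists (1%:R^-1 * a 1%N); exists 0%N.
have mulb k m : a (k * m)%N <= k%:R * a m + a 0%N.
  elim: k => [|k IH]; first by rewrite mul0n mul0r add0r.
  by rewrite mulSn (le_trans (sub _ _))// -natr1; lra.
apply/cvg_ex; exists (inf S); apply/cvgrPdist_le => /= e e0.
have [_ [m _ <-] mlt] := @inf_adherent _ S (e / 2) ltac:(lra) (conj S0 Slb).
(* Bound of the remainder after division of [n] by [m + 1]. As [a 0] need not vanish, it is counted
   twice: once for the multiple of [m + 1], once for the rest. *)
pose M := 2 * a 0%N + m.+1%:R * a 1%N.
have M0 : 0 <= M by rewrite addr_ge0// mulr_ge0.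
near=> n.
have n0 : (0 < n)%N by near: n; exact: nbhs_infty_gt.
have nR : 0 < n%:R :> R by rewrite ltr0n.
have lb : inf S <= n%:R^-1 * a n.
  by apply: ge_inf => //; exists n.-1 => //; rewrite prednK.
rewrite ler0_norm ?subr_le0// opprB lerBlDl.
have Mn : n%:R^-1 * M <= e / 2.
  rewrite mulrC ler_pdivrMr// mulrC -ler_pdivrMr; last lra.
  by near: n; exact: nbhs_infty_ger.
have an : a n <= (n %/ m.+1)%:R * a m.+1 + M.
  rewrite {1}(divn_eq n m.+1) (le_trans (sub _ _))//.
  have := mulb (n %/ m.+1)%N m.+1.
  have := mulb (n %% m.+1)%N 1%N; rewrite muln1.
  have : (n %% m.+1)%:R * a 1%N <= m.+1%:R * a 1%N.
    by rewrite ler_wpM2r// ler_nat ltnW// ltn_mod.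
  rewrite /M; lra.
have : n%:R^-1 * a n <= n%:R^-1 * ((n %/ m.+1)%:R * a m.+1) + n%:R^-1 * M.
  by rewrite -mulrDr ler_wpM2l// invr_ge0 ltW.
have : n%:R^-1 * ((n %/ m.+1)%:R * a m.+1) <= m.+1%:R^-1 * a m.+1.
  rewrite mulrA ler_wpM2r// mulrC ler_pdivrMr// mulrC ler_pdivlMr//.
  by rewrite -natrM ler_nat leq_trunc_div.
move=> h1 h2; apply: (le_trans h2).
by rewrite [in leRHS](splitr e) addrA lerD// (le_trans h1)// ltW.
Unshelve. all: by end_near.
Qed.

End Fekete.

(** * Greedy set cover and fractional packing *)

Section FractionalPacking.
Context {R : realType} {Q I : finType}.
Variable V : I -> {set Q}.

(** A majorant of the harmonic number [1 + 1/2 + ... + 1/k], the ratio lost by greedy covering. *)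
Definition harmonic_bound (k : nat) : R :=
  if k is 0%N then 0 else 1 + ln k%:R.

(** Accounts for one greedy step: if [a] points of a set were uncovered and [b] remain, the [a - b]
    points covered now pay at most [1 / a] each. For [b > 0] this is [1 - b / a <= ln (a / b)]. *)
Lemma harmonic_bound_step (a b : nat) : (b <= a)%N -> (0 < a)%N ->
  harmonic_bound b + (a - b)%:R / a%:R <= harmonic_bound a.
Proof.
case: a => // a; case: b => [|b] ba _ /=.
  by rewrite subn0 divff ?pnatr_eq0// add0r lerDl ln_ge0// ler1n.
have a0 : 0 < a.+1%:R :> R by [].
have b0 : 0 < b.+1%:R :> R by [].
have := expR_ge1Dx (ln (b.+1%:R / a.+1%:R : R)).
rewrite lnK ?posrE ?divr_gt0// ln_div// natrB// mulrBl divff ?gt_eqF//.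
move: (ln b.+1%:R) (ln a.+1%:R) (b.+1%:R / a.+1%:R) => x y z.
lra.
Qed.

Lemma harmonic_bound_le (a b : nat) : (a <= b)%N -> harmonic_bound a <= harmonic_bound b.
Proof.
case: a => [|a]; case: b => [|b] //= ab.
  by rewrite addr_ge0// ln_ge0// ler1n.
by rewrite lerD2l ler_ln ?posrE// ler_nat.
Qed.

(* Greedy set cover with dual fitting: the price of a point is the inverse of
   the number of points newly covered at the step which covers it. *)
Lemma greedy_packing (S : {set Q}) :
  (forall q, q \in S -> exists i, q \in V i) ->
  exists (s : seq I) (y : Q -> R),
    [/\ forall q, q \in S -> exists2 i, i \in s & q \in V i,
        forall q, 0 <= y q, forall q, q \notin S -> y q = 0,
        \sum_q y q = (size s)%:R &
        forall i, \sum_(q in V i) y q <= harmonic_bound #|V i :&: S|].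
Proof.
have [n] := ubnP #|S|; elim: n S => // n IH S Sn Scov.
have [->|[q0 q0S]] := set_0Vmem S.
  exists [::], (fun=> 0); split=> //; first by move=> q; rewrite inE.
    by rewrite big1.
  by move=> i; rewrite big1// finset.setI0 cards0.
have [i0 q0i0] := Scov _ q0S.
have [i _ imax] := @arg_maxnP I i0 xpredT (fun i => #|V i :&: S|) isT.
pose m := #|V i :&: S|.
have m0 : (0 < m)%N.
  apply: (leq_trans _ (imax i0 isT)); apply/card_gt0P; exists q0.
  by rewrite inE q0i0.
pose S' := S :\: V i.
have cS : (#|S'| + m = #|S|)%N by rewrite /S' /m addnC finset.setIC cardsID.
have [||s [y [ys y0 yS' ysum yV]]] := IH S'.
- by move: Sn; rewrite -cS; lia.
- by move=> q; rewrite inE => /andP[_ /Scov].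
exists (i :: s), (fun q => if q \in V i :&: S then m%:R^-1 else y q); split.
- move=> q qS; have [qi|qi] := boolP (q \in V i); first by exists i; rewrite ?mem_head.
  have [|j js qj] := ys q; first by rewrite inE qi.
  by exists j => //; rewrite inE js orbT.
- by move=> q; case: ifP => // _; rewrite invr_ge0.
- move=> q qS; rewrite inE (negbTE qS) andbF yS'// inE.
  by rewrite (negbTE qS) andbF.
- rewrite (bigID (mem (V i :&: S)))/=.
  rewrite (eq_bigr (fun=> m%:R^-1)) => [|q ->//].
  rewrite sumr_const -/m -[X in X + _]mulr_natr mulVf; last by rewrite pnatr_eq0 -lt0n.
  rewrite (eq_bigr y); last by move=> q /negbTE ->.
  rewrite -natr1 -ysum addrC; congr (_ + _).
  rewrite [RHS](bigID (mem (V i :&: S)))/= [X in _ = X + _]big1 ?add0r// => q.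
  by rewrite inE => /andP[qi qS]; apply: yS'; rewrite inE qi.
move=> j.
(* The old prices vanish on [V i :&: S], which is disjoint from [S'], so the new prices are simply
   added. *)
have -> : \sum_(q in V j) (if q \in V i :&: S then m%:R^-1 else y q) =
    \sum_(q in V j) y q + #|V j :&: (V i :&: S)|%:R / m%:R.
  rewrite (bigID (mem (V i :&: S)))/= [X in _ = X + _](bigID (mem (V i :&: S)))/=.
  rewrite (eq_bigr (fun=> m%:R^-1)) => [|q /andP[_ ->]//].
  rewrite sumr_const [X in _ = X + _ + _]big1; last first.
    move=> q /andP[_]; rewrite inE => /andP[qi qS].
    by apply: yS'; rewrite inE qi.
  rewrite add0r.
  rewrite addrC; congr (_ + _).
    by apply: eq_bigr => q /andP[_ /negbTE ->].
  rewrite -[LHS]mulr_natl; congr (_%:R * _).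
  by apply: eq_card => q; rewrite unfold_in/= [in RHS]finset.in_setI.
have ha : (#|V j :&: S'| + #|V j :&: (V i :&: S)| = #|V j :&: S|)%N.
  rewrite -(cardsID (V i) (V j :&: S)) addnC; congr (_ + _)%N.
    by apply: eq_card => q; rewrite !inE; case: (q \in V i); case: (q \in V j); case: (q \in S).
  by apply: eq_card => q; rewrite !inE; case: (q \in V i); case: (q \in V j); case: (q \in S).
have [a0|a0] := posnP #|V j :&: S|.
  have [b0 c0] : #|V j :&: S'| = 0%N /\ #|V j :&: (V i :&: S)| = 0%N by lia.
  by rewrite c0 mul0r addr0 (le_trans (yV j))// harmonic_bound_le// b0.
apply: le_trans (harmonic_bound_step _ a0); last first.
  by rewrite -ha; exact: leq_addr.
have -> : (#|V j :&: S| - #|V j :&: S'|)%N = #|V j :&: (V i :&: S)|.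
  by rewrite -ha addKn.
apply: lerD; first exact: yV.
(* By the greedy choice of [i], [m] is at least [#|V j :&: S|]. *)
by rewrite ler_wpM2l// lef_pV2 ?posrE ?ltr0n// ler_nat; exact: imax.
Qed.

End FractionalPacking.

(** * Borel probability measures on a metric space *)

Section ContinuousFunctions.
Context {R : realType} {X : pointedMetricType R}.
Hypothesis X_compact : compact [set: X].
Implicit Types (f g : X -> R) (mu nu : probability (borelType X) R).

Lemma open_borel (A : set X) : open A -> measurable (A : set (borelType X)).
Proof. exact: sub_sigma_algebra. Qed.

Lemma closed_borel (A : set X) : closed A -> measurable (A : set (borelType X)).
Proof.
by move=> Ac; rewrite -(setCK A); apply: measurableC; apply: open_borel; rewrite openC.
Qed.

Lemma continuous_borel f : continuous f ->
  measurable_fun [set: borelType X] (f : borelType X -> R).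
Proof.
move=> /continuousP cf; apply: (measurability _ (RGenOpens.measurableE R)).
move=> _ [B [x [y ->]] <-]; rewrite setTI.
by apply: open_borel; apply: cf; exact: interval_open.
Qed.

Lemma continuous_map_borel (T : X -> X) : continuous T ->
  measurable_fun [set: borelType X] (T : borelType X -> borelType X).
Proof.
move=> /continuousP cT; apply: (measurability (open : set (set (borelType X)))) => //.
by move=> _ [B Bo <-]; rewrite setTI; apply: open_borel; exact: cT.
Qed.

Lemma preimage_borel (T : X -> X) (A : set X) : continuous T ->
  measurable (A : set (borelType X)) -> measurable (T @^-1` A : set (borelType X)).
Proof.
by move=> /continuous_map_borel mT mA; rewrite -[X in measurable X]setTI; exact: mT.
Qed.

Lemma iter_continuous (T : X -> X) n : continuous T -> continuous (iter n T).
Proof.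
move=> cT; elim: n => [|n IH] x /=; first exact: cvg_id.
by apply: (@continuous_comp _ _ _ (iter n T) T); [exact: IH|exact: cT].
Qed.

Lemma compact_continuous_bounded f : continuous f ->
  exists2 M, 0 <= M & forall x, `|f x| <= M.
Proof.
move=> cf.
have /compact_bounded[M [_ MP]] : compact (f @` [set: X]).
  by apply: continuous_compact => //; exact: continuous_subspaceT.
exists (`|M| + 1); first by rewrite addr_ge0.
move=> x; apply: (MP (`|M| + 1)); last by exists x.
by rewrite (le_lt_trans (ler_norm _))// ltrDl.
Qed.

Lemma continuous_integrable mu f : continuous f ->
  mu.-integrable [set: borelType X] (EFin \o f).
Proof.
move=> cf; apply: measurable_bounded_integrable => //.
- by rewrite (le_lt_trans (probability_le1 _ _))// ltry.
- exact: continuous_borel.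
- have [M _ fM] := compact_continuous_bounded cf.
  exists M; split; first exact: num_real.
  by move=> y My x _; rewrite /= (le_trans (fM x))// ltW.
Qed.

Lemma urysohn_between (K O : set X) : closed K -> open O -> K `<=` O ->
  exists f, [/\ continuous f, forall x, 0 <= f x <= 1,
    forall x, K x -> f x = 1 & forall x, ~ O x -> f x = 0].
Proof.
move=> Kc Oo KO.
have nX : normal_space X by apply: compact_normal => //; exact: metric_hausdorff.
have us : uniform_separator (~` O) K.
  apply: (iffLR (@normal_separatorP R X) nX) => //; first by rewrite closedC.
  by apply/seteqP; split => // x [/= nO /KO].
exists (Urysohn (~` O) K : X -> R); split.
- exact: Urysohn_continuous.
- move=> x; have := @Urysohn_range _ R (~` O) K (Urysohn (~` O) K x).
  by move=> /(_ (ex_intro2 _ _ x I erefl)); rewrite /= in_itv.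
- by move=> x Kx; apply: (Urysohn_sub1 us); exists x.
- by move=> x Ox; apply: (Urysohn_sub0 us); exists x.
Qed.

End ContinuousFunctions.

Section RealMeasure.
Context {R : realType} {X : pointedMetricType R}.
Implicit Types (mu nu : probability (borelType X) R) (A B : set X).

Definition prb mu A : R := fine (mu A).

Local Notation mble A := (measurable (A : set (borelType X))).

Lemma prbE mu A : mble A -> mu A = (prb mu A)%:E.
Proof. by move=> mA; rewrite /prb fineK// fin_num_measure. Qed.

Lemma prb_ge0 mu A : 0 <= prb mu A.
Proof. by rewrite /prb fine_ge0. Qed.

Lemma prb_le1 mu A : mble A -> prb mu A <= 1.
Proof. by move=> mA; rewrite -lee_fin -prbE// probability_le1. Qed.

Lemma prb_setT mu : prb mu setT = 1.
Proof. by rewrite /prb probability_setT. Qed.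

Lemma prb_set0 mu : prb mu set0 = 0.
Proof. by rewrite /prb measure0. Qed.

Lemma prb_le mu A B : mble A -> mble B -> A `<=` B -> prb mu A <= prb mu B.
Proof.
by move=> mA mB AB; rewrite -lee_fin -!prbE// le_measure// inE.
Qed.

Lemma prb_setU mu A B : mble A -> mble B -> A `&` B = set0 ->
  prb mu (A `|` B) = prb mu A + prb mu B.
Proof.
move=> mA mB AB; apply: EFin_inj; rewrite EFinD -!prbE//; last exact: measurableU.
exact: measureU.
Qed.

Lemma prb_setD mu A B : mble A -> mble B -> B `<=` A ->
  prb mu (A `\` B) = prb mu A - prb mu B.
Proof.
move=> mA mB BA.
have -> : prb mu A = prb mu (A `\` B) + prb mu B.
  rewrite -prb_setU//; last 2 first.
  - exact: measurableD.
  - by apply/seteqP; split => // x [[]].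
  congr prb; apply/seteqP; split => x; last by move=> [[]//|/BA].
  by move=> Ax; have [Bx|Bx] := pselect (B x); [right|left].
by rewrite addrK.
Qed.

Lemma prb_setC mu A : mble A -> prb mu (~` A) = 1 - prb mu A.
Proof. by move=> mA; rewrite -setTD prb_setD// prb_setT. Qed.

Lemma prb_setUle mu A B : mble A -> mble B ->
  prb mu (A `|` B) <= prb mu A + prb mu B.
Proof.
move=> mA mB; rewrite -lee_fin EFinD -!prbE//; last exact: measurableU.
exact: measureU2.
Qed.

Lemma prb_fibers mu (J : finType) (phi : X -> J) (A : set X) :
  (forall j, mble (phi @^-1` [set j])) -> mble A ->
  \sum_j prb mu (A `&` phi @^-1` [set j]) = prb mu A.
Proof.
move=> mphi mA; apply: EFin_inj; rewrite -sumEFin -prbE//.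
rewrite (eq_bigr (fun j => mu (A `&` phi @^-1` [set j])))%E; last first.
  by move=> j _; rewrite prbE//; exact: measurableI.
have AE : A = \bigcup_(j in [set: J]) (A `&` phi @^-1` [set j]).
  by apply/seteqP; split => [x Ax|x [j _ []]//]; exists (phi x).
have JE : [set: J] = [set` enum J].
  by apply/seteqP; split => // j _ /=; rewrite mem_enum.
rewrite [in RHS]AE measure_fin_bigcup.
- by rewrite JE -fsbig_seq ?enum_uniq// big_enum.
- by rewrite JE; exact: finite_seq.
- by move=> i j _ _ [x [[_ /= <-] [_ /= <-]]].
- by move=> j _; exact: measurableI.
Qed.

Lemma prb_bigcup_lt mu (F : nat -> set X) (e : R) : (forall n, mble (F n)) ->
  (forall n, F n `<=` F n.+1) -> 0 < e ->
  exists n, prb mu (\bigcup_k F k) - e < prb mu (F n).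
Proof.
move=> mF FS e0.
have mU : mble (\bigcup_k F k) by exact: bigcupT_measurable.
have : mu (F n) @[n --> \oo] --> mu (\bigcup_k F k).
  apply: nondecreasing_cvg_mu => //.
  by apply/nondecreasing_seqP => n; apply/subsetPset; exact: FS.
rewrite prbE// => /fine_cvgP[_] /cvgrPdist_lt /(_ _ e0) [n _ /(_ n (leqnn n))] h.
exists n; move: h; rewrite ltr_distlC/= => /andP[+ _].
by rewrite ltrBlDr -ltrBlDl ltrBlDr addrC.
Qed.

Lemma prb_bigcap_lt mu (F : nat -> set X) (e : R) : (forall n, mble (F n)) ->
  (forall n, F n.+1 `<=` F n) -> prb mu (\bigcap_k F k) = 0 -> 0 < e ->
  exists n, prb mu (F n) < e.
Proof.
move=> mF FS F0 e0.
have [n|n|n nP] := @prb_bigcup_lt mu (fun n => ~` F n) e _ _ e0.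
- exact: measurableC.
- by apply: subsetC; exact: FS.
- exists n; move: nP; rewrite -setC_bigcap !prb_setC// ?F0; first lra.
  exact: bigcapT_measurable.
Qed.

End RealMeasure.

(** * Regularity of Borel probability measures *)

Section Regularity.
Context {R : realType} {X : pointedMetricType R}.
Variable mu : probability (borelType X) R.
Local Notation mble A := (measurable (A : set (borelType X))).

Lemma open_exhaustion (O : set X) : open O ->
  exists F : nat -> set X, [/\ forall n, closed (F n), forall n, F n `<=` F n.+1 &
    \bigcup_n F n = O].
Proof.
move=> Oo; exists (fun n => [set x | ball x n.+1%:R^-1 `<=` O]); split.
- move=> n x xF z; rewrite ballEmdist /= => xz; apply: contrapT => zO.
  pose r := n.+1%:R^-1 - mdist x z.
  have r0 : 0 < r by rewrite /r subr_gt0.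
  have [y [yF]] := xF _ (nbhsx_ballx x (PosNum r0)%:num (gt0 (PosNum r0))).
  rewrite ballEmdist /= => xy; apply: zO; apply: yF.
  rewrite ballEmdist /=; apply: (le_lt_trans (metric_triangle _ x _)).
  by rewrite metric_sym -ltrBrDr.
- move=> n x xF z zx; apply: xF; apply: le_ball zx.
  by rewrite lef_pV2 ?posrE// ler_nat.
- apply/seteqP; split => [x [n _ xF]|x Ox]; first by apply: xF; exact: ballxx.
  have /nbhs_ballP[e /= e0 eO] : nbhs x O by exact: open_nbhs_nbhs.
  have [n _ /(_ n (leqnn n)) /= ne] := near_infty_natSinv_lt (PosNum e0).
  by exists n => // z zx; apply: eO; apply: le_ball zx; exact: ltW.
Qed.

(** The sets with this property form a sigma-algebra containing the open sets. Complements exchange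
    [K] and [O]. For a countable union, the sets are approximated with errors [e / 2 / 2^(n+1)], and
    replacing the union of the inner sets by a finite, hence closed, partial union costs less than
    another [e / 2]. *)
Lemma borel_regular (A : set X) (e : R) : mble A -> 0 < e ->
  exists K O, [/\ closed K, open O, K `<=` A, A `<=` O & prb mu (O `\` K) < e].
Proof.
pose H : set (set X) := [set A | mble A /\ forall e : R, 0 < e ->
  exists K O, [/\ closed K, open O, K `<=` A, A `<=` O & prb mu (O `\` K) < e]].
suff HP : H `<=` H /\ <<s (@open X) >> `<=` H.
  by move=> mA e0; case: HP => _ HP; have [_] := HP _ mA; exact.
split=> //; apply: smallest_sub; last first.
  move=> O Oo; split; first exact: open_borel.
  move=> {}e e0; have [F [Fc FS FO]] := open_exhaustion Oo.
  have mF n : mble (F n) by exact: closed_borel.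
  have [n nP] := @prb_bigcup_lt _ _ mu F e mF FS e0.
  have FnO : F n `<=` O by rewrite -FO => x Fx; exists n.
  exists (F n), O; split => //.
  by move: nP; rewrite FO prb_setD//; [lra|exact: open_borel].
split.
- split; first exact: measurable0.
  move=> {}e e0; exists set0, set0; split => //; first exact: closed0.
    exact: open0.
  by rewrite setD0 prb_set0.
- move=> {}A [mA AP]; split; first exact: measurableD.
  move=> {}e e0; have [K [W [Kc Wo KA AW KWe]]] := AP _ e0.
  exists (~` W), (~` K); split; rewrite ?closedC ?openC// ?setTD.
  + exact: subsetC.
  + exact: subsetC.
  + by rewrite setDE setCK setIC -setDE.
- move=> F FH; have mU : mble (\bigcup_k F k).
    by apply: bigcupT_measurable => n; have [] := FH n.
  split=> // {}e e0.
  pose d n := e / 2 / (2 ^ n.+1)%:R.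
  have d0 n : 0 < d n by rewrite !divr_gt0// ltr0n expn_gt0.
  have /choice[KO KOP] n : exists KO : set X * set X,
      [/\ closed KO.1, open KO.2, KO.1 `<=` F n, F n `<=` KO.2 & prb mu (KO.2 `\` KO.1) < d n].
    by have [_ FHn] := FH n; have [K [W ?]] := FHn _ (d0 n); exists (K, W).
  pose O := \bigcup_n (KO n).2.
  pose K n := \big[setU/set0]_(i < n) (KO i).1.
  have Kc n : closed (K n).
    by apply: closed_bigsetU => i _; have [] := KOP i.
  have Oo : open O by apply: bigcup_open => i _; have [] := KOP i.
  have KS n : K n `<=` K n.+1 by rewrite /K big_ord_recr; exact: subsetUl.
  have [n nP] := @prb_bigcup_lt _ _ mu K (e / 2) (fun n => closed_borel (Kc n)) KS ltac:(lra).
  have KF m : K m `<=` \bigcup_k F k.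
    rewrite /K -(bigcup_mkord m (fun i => (KO i).1)) => x [i _ Kx]; exists i => //.
    by have [_ _ KFi _ _] := KOP i; exact: KFi.
  have FO : \bigcup_k F k `<=` O.
    by move=> x [i _ Fx]; exists i => //; have [_ _ _ FOi _] := KOP i; exact: FOi.
  exists (K n), O; split => //.
  have mO := open_borel Oo; have mK m := closed_borel (Kc m).
  have mKU : mble (\bigcup_m K m) by exact: bigcupT_measurable.
  have KUO : \bigcup_m K m `<=` O by move=> x [m _ /KF /FO].
  suff : prb mu (O `\` \bigcup_m K m) <= e / 2.
    rewrite !prb_setD//; last by move=> x /KF /FO.
    lra.
  have mKO m : mble ((KO m).2 `\` (KO m).1).
    by have [? ? _ _ _] := KOP m; apply: measurableD; [exact: open_borel|exact: closed_borel].
  rewrite -lee_fin -prbE; last exact: measurableD.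
  apply: (@le_trans _ _ (\sum_(m <oo) mu ((KO m).2 `\` (KO m).1))%E).
    apply: measure_sigma_subadditive => //; first exact: measurableD.
    move=> x [[m _ Ox] nK]; exists m => //; split=> // Kx; apply: nK.
    by exists m.+1 => //; rewrite /K big_ord_recr; right.
  apply: (@le_trans _ _ (\sum_(m <oo) (d m)%:E)%E).
    apply: lee_nneseries => [m * |m *]; first exact: measure_ge0.
    by rewrite prbE// lee_fin ltW//; have [] := KOP m.
  by apply: (epsilon_trick0 xpredT); lra.
Qed.

End Regularity.

(** * The weak-star topology *)

Section WeakStar.
Context {R : realType} {X : pointedMetricType R}.
Hypothesis X_compact : compact [set: X].
Local Notation prob := (probability (borelType X) R).
Local Notation wstar := (@weak_star R X).
Local Notation mble A := (measurable (A : set (borelType X))).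
Implicit Types (mu nu : prob) (f : X -> R).

Definition expect mu f : R := \int[mu]_(x in [set: X]) f x.

Lemma expectE mu f : continuous f ->
  (\int[mu]_(x in [set: X]) (f x)%:E)%E = (expect mu f)%:E.
Proof.
move=> cf; rewrite /expect /Rintegral fineK//.
by apply: integrable_fin_num => //; exact: (continuous_integrable X_compact).
Qed.

Lemma expect_le mu f g : continuous f -> continuous g ->
  (forall x, f x <= g x) -> expect mu f <= expect mu g.
Proof.
move=> cf cg fg; apply: le_Rintegral => //.
- exact: (continuous_integrable X_compact).
- exact: (continuous_integrable X_compact).
Qed.

Lemma expect_cst mu (c : R) : expect mu (fun=> c) = c.
Proof.
by rewrite /expect Rintegral_cst// [fine _](prb_setT mu) mulr1.
Qed.

Lemma expectD mu f g : continuous f -> continuous g ->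
  expect mu (fun x => f x + g x) = expect mu f + expect mu g.
Proof.
by move=> cf cg; apply: RintegralD => //; exact: (continuous_integrable X_compact).
Qed.

Lemma expectZ mu f (c : R) : continuous f ->
  expect mu (fun x => c * f x) = c * expect mu f.
Proof.
by move=> cf; apply: RintegralZl => //; exact: (continuous_integrable X_compact).
Qed.

Lemma prb_le_expect mu f (K : set X) : continuous f -> (forall x, 0 <= f x) ->
  mble K -> (forall x, K x -> 1 <= f x) -> prb mu K <= expect mu f.
Proof.
move=> cf f0 mK fK; rewrite -lee_fin -prbE// -expectE//.
have <- : (\int[mu]_(x in [set: X]) (\1_K x)%:E)%E = mu K.
  by rewrite integral_indic// setIT.
apply: ge0_le_integral; first exact: measurableT.
- by move=> x _; rewrite lee_fin.
- by apply/measurable_EFinP; exact: measurable_indic.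
- by apply/measurable_EFinP; exact: continuous_borel.
- move=> x _; rewrite lee_fin indicE; case: (boolP (x \in K)) => //=.
  by rewrite inE => /fK.
Qed.

Lemma expect_le_prb mu f (O : set X) : continuous f ->
  (forall x, 0 <= f x <= 1) -> mble O -> (forall x, ~ O x -> f x = 0) ->
  expect mu f <= prb mu O.
Proof.
move=> cf f01 mO fO; rewrite -lee_fin -prbE// -expectE//.
have <- : (\int[mu]_(x in [set: X]) (\1_O x)%:E)%E = mu O.
  by rewrite integral_indic// setIT.
apply: ge0_le_integral; first exact: measurableT.
- by move=> x _; rewrite lee_fin; case/andP: (f01 x).
- by apply/measurable_EFinP; exact: continuous_borel.
- by apply/measurable_EFinP; exact: measurable_indic.
- move=> x _; rewrite lee_fin indicE; case: (boolP (x \in O)) => //=.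
    by case/andP: (f01 x).
  by move=> /negP; rewrite inE => /fO ->.
Qed.

Lemma initial_topology_cvg (S : choiceType) (Y : topologicalType) (h : S -> Y)
    (F : set_system S) (s : S) : Filter F ->
  h x @[x --> F] --> h s -> F --> (s : initial_topology h).
Proof.
move=> FF hF A /= [_ [[B Bo <-] Bhs sBA]].
have hB : nbhs (h s) B by apply: open_nbhs_nbhs.
by apply: (@filterS _ F FF _ _ sBA); exact: hF.
Qed.

Lemma weak_star_cvg (F : set_system prob) mu : Filter F ->
  (forall f : continuousType X R, expect nu f @[nu --> F] --> expect mu f) ->
  F --> (mu : wstar).
Proof.
move=> FF h; apply: initial_topology_cvg; apply/cvg_sup => f.
by apply: initial_topology_cvg; exact: h.
Qed.

Lemma expect_continuous (f : continuousType X R) :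
  continuous ((fun nu => expect nu f) : wstar -> R).
Proof.
move=> mu.
pose h := fun nu : prob => (fun f : continuousType X R => expect nu f) : {ptws continuousType X R -> R}.
apply: (@continuous_comp wstar {ptws continuousType X R -> R} R h
  (fun g : {ptws continuousType X R -> R} => g f)).
  exact: initial_continuous.
move: (h mu) => g A gA.
have /cvg_sup /(_ f) : nbhs g --> g by [].
apply; exact: (@initial_continuous _ _ (fun g : continuousType X R -> R => g f)).
Qed.

(** Instead of unfolding the nested initial topologies, the sets of this shape are shown to generate
    a filter that converges to [mu]; every neighbourhood then contains one of them. *)
Lemma weak_star_nbhs mu (B : set prob) : nbhs (mu : wstar) B ->
  exists (n : nat) (fs : nat -> continuousType X R) (d : R), 0 < d /\
    forall nu, (forall i, (i < n)%N -> `|expect nu (fs i) - expect mu (fs i)| <= d) ->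
      B nu.
Proof.
pose D := (nat * (nat -> continuousType X R) * R)%type.
pose N (p : D) : set prob := [set nu | forall i, (i < p.1.1)%N ->
  `|expect nu (p.1.2 i) - expect mu (p.1.2 i)| <= p.2].
pose F := filter_from [set p : D | 0 < p.2] N.
have cstT : continuous (fun _ : X => 0 : R) by move=> x; exact: cvg_cst.
have FF : Filter F.
  apply: filter_from_filter; first by exists (0%N, fun=> (mkcts cstT : continuousType X R), 1); exact: ltr01.
  move=> [[n fs] d] [[n' fs'] d'] /= d0 d'0.
  exists ((n + n')%N, (fun i => if (i < n)%N then fs i else fs' (i - n)%N), Num.min d d').
    by rewrite /= lt_min d0.
  move=> nu /= H; split=> i /= il.
    have := H i; rewrite /N /= il => H'.
    by apply: le_trans (H' _) _; [lia|rewrite ge_min lexx].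
  have := H (n + i)%N; rewrite /N /= [(n + i < n)%N]ltnNge leq_addr /= addKn => H'.
  by apply: le_trans (H' _) _; [lia|rewrite ge_min lexx orbT].
have Fmu : F --> (mu : wstar).
  apply: weak_star_cvg => f; apply/cvgrPdist_le => /= e e0.
  exists (1%N, fun=> f, e) => //= nu /(_ 0%N isT).
  by rewrite distrC.
by move=> /Fmu [[[n fs] d] /= d0 NB]; exists n, fs, d; split.
Qed.

(** Half of the portmanteau theorem: by regularity [O] contains a closed set of mass above [c], and
    a Urysohn function between the two has an expectation that is weak-star continuous and bounds
    [prb nu O] from below. *)
Lemma weak_star_open_lsc mu (O : set X) (c : R) : open O -> c < prb mu O ->
  \forall nu \near (mu : wstar), c < prb nu O.
Proof.
move=> Oo cO; have mO := open_borel Oo.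
have [K [W [Kc Wo KO OW KWe]]] := borel_regular mu mO (ltac:(lra) : 0 < prb mu O - c).
have mK := closed_borel Kc.
have cK : c < prb mu K.
  have : prb mu (O `\` K) <= prb mu (W `\` K).
    apply: prb_le; last by move=> x [/OW].
      exact: measurableD.
    by apply: measurableD => //; exact: open_borel.
  by rewrite prb_setD//; lra.
have [f [cf f01 fK fO]] := urysohn_between X_compact Kc Oo KO.
have : c < expect mu f.
  apply: lt_le_trans cK _; apply: prb_le_expect => //.
    by move=> x; case/andP: (f01 x).
  by move=> x /fK ->.
move=> cf'; have h0 := @expect_continuous (mkcts cf) mu.
apply: filterS (cvgr_gt (expect mu f) h0 c cf') => nu /= h.
by apply: lt_le_trans h _; exact: expect_le_prb.
Qed.

End WeakStar.

(** * Weak-star compactness *)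

Section ContentExtension.
Context {R : realType} {X : pointedMetricType R}.
Hypothesis X_compact : compact [set: X].
Variable m : set X -> R.
Hypothesis m0 : m set0 = 0.
Hypothesis mT : m [set: X] = 1.
Hypothesis m_le : forall K L, closed K -> closed L -> K `<=` L -> m K <= m L.
Hypothesis m_setU : forall K L, closed K -> closed L -> m (K `|` L) <= m K + m L.
Hypothesis m_disjoint : forall K L, closed K -> closed L -> K `&` L = set0 ->
  m (K `|` L) = m K + m L.

(** Meant for open [G]. As in the construction of a Radon measure from a content, [outer_content]
    then extends it to all sets by outer approximation. *)
Definition inner_content (G : set X) : R :=
  sup [set m K | K in [set K | closed K /\ K `<=` G]].

Let inner_has_sup G :
  has_sup [set m K | K in [set K | closed K /\ K `<=` G]].
Proof.
split; first by exists (m set0); exists set0 => //; split=> //; exact: closed0.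
by exists 1 => _ [K [Kc _] <-]; rewrite -mT; apply: m_le => //; exact: closedT.
Qed.

Lemma inner_content_ge K G : closed K -> K `<=` G -> m K <= inner_content G.
Proof.
by move=> Kc KG; apply: sup_upper_bound; [exact: inner_has_sup|exists K].
Qed.

Lemma inner_content_le G (c : R) :
  (forall K, closed K -> K `<=` G -> m K <= c) -> inner_content G <= c.
Proof.
move=> h; apply: ge_sup; first by have [] := inner_has_sup G.
by move=> _ [K [Kc KG] <-]; exact: h.
Qed.

Lemma inner_content_ge0 G : 0 <= inner_content G.
Proof. by rewrite -m0; apply: inner_content_ge => //; exact: closed0. Qed.

(** Normality separates the disjoint closed sets [K \ G] and [K \ H], which writes [K] as a union of
    a closed subset of [G] and a closed subset of [H]. *)
Lemma inner_content_setU G H : open G -> open H ->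
  inner_content (G `|` H) <= inner_content G + inner_content H.
Proof.
move=> Go Ho; apply: inner_content_le => K Kc KGH.
have nX : normal_space X by apply: compact_normal => //; exact: metric_hausdorff.
have [|||V [W [Vo Wo KV KW VW]]] :=
  iffLR (@normal_openP R X) nX (K `\` G) (K `\` H).
- by rewrite setDE; apply: closedI => //; rewrite closedC.
- by rewrite setDE; apply: closedI => //; rewrite closedC.
- by apply/seteqP; split => // x [[Kx nG] [_ nH]]; have [] := KGH _ Kx.
have KVc : closed (K `\` V) by rewrite setDE; apply: closedI => //; rewrite closedC.
have KWc : closed (K `\` W) by rewrite setDE; apply: closedI => //; rewrite closedC.
have KE : K = (K `\` V) `|` (K `\` W).
  by rewrite -setDIr VW setD0.
rewrite KE; apply: (le_trans (m_setU KVc KWc)); apply: lerD.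
  apply: inner_content_ge => // x [Kx nV]; apply: contrapT => nG.
  by apply: nV; exact: KV.
apply: inner_content_ge => // x [Kx nW]; apply: contrapT => nH.
by apply: nW; exact: KW.
Qed.

(** The sets [K] tested by the supremum are compact, so each lies in finitely many [G n] and finite
    subadditivity applies. *)
Lemma inner_content_bigcup (G : nat -> set X) : (forall n, open (G n)) ->
  ((inner_content (\bigcup_n G n))%:E <= \sum_(n <oo) (inner_content (G n))%:E)%E.
Proof.
move=> Go.
have ser n : inner_content (\bigcup_(i < n) G i) <= \sum_(i < n) inner_content (G i).
  elim: n => [|n IH].
    rewrite bigcup_mkord !big_ord0; apply: inner_content_le => K Kc.
    by rewrite subset0 => ->; rewrite m0.
  rewrite bigcup_mkord !big_ord_recr /= -bigcup_mkord.
  apply: le_trans (inner_content_setU _ _) _; last by rewrite lerD2r.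
    by apply: bigcup_open => i _; exact: Go.
  exact: Go.
have bnd K : closed K -> K `<=` \bigcup_n G n ->
    ((m K)%:E <= \sum_(n <oo) (inner_content (G n))%:E)%E.
  move=> Kc KG.
  have Kcomp : compact K by exact: subclosed_compact X_compact _.
  have [n Kn] : exists n : nat, K `<=` \bigcup_(i < n) G i.
    move: Kcomp; rewrite compact_cover => /(_ nat setT G).
    move=> /(_ (fun i _ => Go i) KG)[D _ KD].
    exists (\max_(i <- finmap.enum_fset D) i.+1)%N => x /KD[i iD Gx]; exists i => //=.
    by apply: (@leq_bigmax_seq _ (finmap.enum_fset D) xpredT (fun i => i.+1)).
  apply: (@le_trans _ _ (\sum_(0 <= i < n) (inner_content (G i))%:E)%E).
    rewrite sumEFin lee_fin big_mkord; apply: le_trans (ser n).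
    exact: inner_content_ge.
  by apply: nneseries_lim_ge => i _; rewrite lee_fin inner_content_ge0.
have [->|nfin] := eqVneq (\sum_(n <oo) (inner_content (G n))%:E)%E +oo%E.
  by rewrite leey.
have sge0 : (0 <= \sum_(n <oo) (inner_content (G n))%:E)%E.
  by apply: nneseries_ge0 => i _ _; rewrite lee_fin inner_content_ge0.
have fin : (\sum_(n <oo) (inner_content (G n))%:E)%E \is a fin_num.
  by rewrite ge0_fin_numE// lt_neqAle nfin leey.
rewrite -(fineK fin) lee_fin; apply: inner_content_le => K Kc KG.
by rewrite -lee_fin fineK//; exact: bnd.
Qed.

Definition outer_content (A : set X) : \bar R :=
  ereal_inf [set (inner_content G)%:E | G in [set G | open G /\ A `<=` G]].

Let outer_content_le A G : open G -> A `<=` G ->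
  (outer_content A <= (inner_content G)%:E)%E.
Proof. by move=> Go AG; apply: ereal_inf_lbound; exists G. Qed.

Let outer_content_ge0 A : (0 <= outer_content A)%E.
Proof.
by apply: le_ereal_inf_tmp => _ [G _ <-]; rewrite lee_fin inner_content_ge0.
Qed.

Let outer_content0 : outer_content set0 = 0%E.
Proof.
apply/eqP; rewrite eq_le outer_content_ge0 andbT.
apply: le_trans (outer_content_le open0 (@subset_refl _ _)) _.
rewrite lee_fin; apply: inner_content_le => K Kc.
by rewrite subset0 => ->; rewrite m0.
Qed.

Let outer_content_fin A : outer_content A \is a fin_num.
Proof.
rewrite ge0_fin_numE//; apply: le_lt_trans (ltry (inner_content setT)).
by apply: outer_content_le => //; exact: openT.
Qed.

Let outer_content_sigma_subadditive A F :
  subset_sigma_subadditive outer_content A F.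
Proof.
move=> AF; apply/lee_addgt0Pr => e e0.
pose d n := e / (2 ^ n.+1)%:R.
have d0 n : 0 < d n by rewrite divr_gt0// ltr0n expn_gt0.
have /choice[G GP] n : exists G, [/\ open G, F n `<=` G &
    ((inner_content G)%:E <= outer_content (F n) + (d n)%:E)%E].
  have [_ [G [Go FG] <-] lt] := lb_ereal_inf_adherent (d0 n) (outer_content_fin (F n)).
  by exists G; split=> //; exact: ltW.
apply: (@le_trans _ _ (inner_content (\bigcup_n G n))%:E).
  apply: outer_content_le.
    by apply: bigcup_open => i _; have [] := GP i.
  move=> x /AF[i _ Fx]; exists i => //; have [_ FG _] := GP i; exact: FG.
apply: le_trans (inner_content_bigcup _) _; first by move=> n; have [] := GP n.
apply: le_trans (epsilon_trick xpredT _ (ltW e0)); last by [].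
apply: lee_nneseries => [i *|i *]; first by rewrite lee_fin inner_content_ge0.
by have [] := GP i.
Qed.

HB.instance Definition _ := isSubsetOuterMeasure.Build R X outer_content
  outer_content0 outer_content_ge0 outer_content_sigma_subadditive.

(** For an open [W] containing the test set, exhaust [W & G] by a closed [K], then [W \ K] by a
    closed [L]: these are disjoint, so [m_disjoint] bounds the sum of their contents by that of
    [W]. *)
Lemma open_caratheodory (G : set X) : open G -> outer_content.-caratheodory G.
Proof.
move=> Go; apply: le_caratheodory_measurable => Y.
apply: le_ereal_inf_tmp => _ [W [Wo YW] <-].
have WGo : open (W `&` G) by exact: openI.
have KY K : closed K -> K `<=` W `&` G ->
    ((m K)%:E + outer_content (Y `&` ~` G) <= (inner_content W)%:E)%E.
  move=> Kc KWG.
  have WKo : open (W `\` K) by rewrite setDE; apply: openI => //; rewrite openC.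
  apply: (@le_trans _ _ ((m K)%:E + (inner_content (W `\` K))%:E)%E).
    rewrite leeD2l//; apply: outer_content_le => //.
    by move=> y [Yy nG]; split; [exact: YW|move=> /KWG[]].
  rewrite -EFinD lee_fin -lerBrDl; apply: inner_content_le => L Lc LWK.
  rewrite lerBrDl -m_disjoint//; last first.
    by apply/seteqP; split => // x [Kx /LWK[]].
  apply: inner_content_ge; first exact: closedU.
  by move=> x [/KWG[]//|/LWK[]].
apply: (@le_trans _ _ ((inner_content (W `&` G))%:E + outer_content (Y `&` ~` G))%E).
  by rewrite leeD2r//; apply: outer_content_le => // y [/YW].
rewrite -(fineK (outer_content_fin (Y `&` ~` G))) -EFinD lee_fin -lerBrDr.
apply: inner_content_le => K Kc KWG.
by rewrite lerBrDr -lee_fin EFinD fineK//; exact: KY.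
Qed.

Let outer_borel (A : set (borelType X)) : measurable A ->
  outer_content.-cara.-measurable A.
Proof.
apply: smallest_sub; last exact: open_caratheodory.
exact: (@sigma_algebra_measurable _ (caratheodory_type outer_content)).
Qed.

Definition content_measure : set (borelType X) -> \bar R := outer_content.

Let content_measure0 : content_measure set0 = 0%E. Proof. exact: outer_content0. Qed.

Let content_measure_ge0 A : (0 <= content_measure A)%E.
Proof. exact: outer_content_ge0. Qed.

Let content_measure_sigma_additive : semi_sigma_additive content_measure.
Proof.
move=> F mF tF mUF; apply: caratheodory_measure_sigma_additive => //.
  by move=> i; exact: outer_borel.
exact: outer_borel.
Qed.

HB.instance Definition _ := isMeasure.Build _ _ _ content_measure
  content_measure0 content_measure_ge0 content_measure_sigma_additive.

Let content_measureT : content_measure setT = 1%E.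
Proof.
apply/eqP; rewrite eq_le; apply/andP; split.
  apply: le_trans (outer_content_le openT (@subset_refl _ _)) _.
  by rewrite lee_fin; apply: inner_content_le => K Kc _; rewrite -mT m_le//; exact: closedT.
apply: le_ereal_inf_tmp => _ [G [_ TG] <-]; rewrite lee_fin -mT.
by apply: inner_content_ge => //; exact: closedT.
Qed.

HB.instance Definition _ := Measure_isProbability.Build _ _ _ content_measure
  content_measureT.

(** Only an inequality: [prb mu K] is an infimum over open neighbourhoods of [K], whereas a limit of
    masses of [K] misses the mass that approaches [K] from outside. *)
Lemma content_extension : exists mu : probability (borelType X) R,
  forall K, closed K -> m K <= prb mu K.
Proof.
exists (content_measure : probability (borelType X) R) => K Kc.
rewrite -lee_fin -prbE; last exact: closed_borel.
apply: le_ereal_inf_tmp => _ [G [_ KG] <-]; rewrite lee_fin.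
exact: inner_content_ge.
Qed.

End ContentExtension.

Section WeakStarCompact.
Context {R : realType} {X : pointedMetricType R}.
Hypothesis X_compact : compact [set: X].
Local Notation prob := (probability (borelType X) R).
Local Notation wstar := (@weak_star R X).
Implicit Types (mu nu : prob) (f g : X -> R).

Lemma ultra_cvg (T : Type) (F : set_system T) (h : T -> R) (a b : R) :
  UltraFilter F -> (forall t, a <= h t <= b) -> exists l : R, h t @[t --> F] --> l.
Proof.
move=> FU hab.
have [|l [_ lcl]] := @segment_compact R a b (fmap h F) _.
  have FF : Filter F by case: FU => -[].
  rewrite /fmap /=; apply: (@filterS _ F _ setT) filterT => t _ /=.
  by rewrite in_itv /=; exact: hab.
exists l => B lB; have [//|nB] := in_ultra_setVsetC (h @^-1` B) FU.
have [x [nBx Bx]] := lcl (~` B) B nB lB.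
by case: (nBx Bx).
Qed.

Lemma cvg_sum_ord (T : Type) (F : set_system T) (a : nat -> T -> R) (l : nat -> R) n :
  Filter F -> (forall i, a i x @[x --> F] --> l i) ->
  (\sum_(i < n) a i x) @[x --> F] --> \sum_(i < n) l i.
Proof.
move=> FF al; elim: n => [|n IH].
  by rewrite big_ord0; under eq_fun do rewrite big_ord0; exact: cvg_cst.
rewrite big_ord_recr; under eq_fun do rewrite big_ord_recr.
by apply: cvgD; [exact: IH|exact: al].
Qed.

Definition clamp (t : R) : R := Num.max 0 (Num.min 1 t).

Lemma clamp_continuous : continuous clamp.
Proof.
move=> x; apply: (@continuous_max R R (fun=> 0) (fun t => Num.min 1 t)).
  exact: cvg_cst.
apply: (@continuous_min R R (fun=> 1) (fun t => t)); first exact: cvg_cst.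
exact: cvg_id.
Qed.

Lemma clamp_itv t : 0 <= clamp t <= 1.
Proof. by rewrite /clamp le_max lexx /= ge_max ler01 ge_min lexx. Qed.

(** A continuous layer-cake decomposition of [t] into slices of height one. *)
Lemma sum_clamp (t : R) n : 0 <= t -> \sum_(j < n) clamp (t - j%:R) = Num.min t n%:R.
Proof.
move=> t0; elim: n => [|n IH]; first by rewrite big_ord0 min_r.
rewrite big_ord_recr /= IH -natr1 /clamp.
have n0 : 0 <= n%:R :> R by [].
move: n%:R n0 => r r0; have [tr|rt] := leP t r.
  by rewrite max_l ?ge_min ?min_l ?addr0//; [lra|apply/orP; right; lra].
have [tr1|rt1] := leP t (r + 1).
  by rewrite [Num.min 1 _]min_r ?max_r//; lra.
by rewrite [Num.min 1 _]min_l ?max_r//; lra.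
Qed.

Lemma expect_sum mu n (F : nat -> X -> R) : (forall i, continuous (F i)) ->
  expect mu (fun x => \sum_(i < n) F i x) = \sum_(i < n) expect mu (F i).
Proof.
move=> cF; elim: n => [|n IH].
  rewrite big_ord0 -[RHS](expect_cst mu 0); congr expect.
  by apply/funext => x; rewrite big_ord0.
rewrite big_ord_recr /= -IH -expectD//.
  by congr expect; apply/funext => x; rewrite big_ord_recr.
by move=> x; apply: (@cvg_sum_ord _ (nbhs x) F (fun i => F i x)) => i; exact: cF.
Qed.

Section LimitOfIntegrals.
Variables (F : set_system prob) (m : set X -> R) (mu : prob).
Hypothesis FF : ProperFilter F.
Hypothesis Fm : forall K, closed K -> prb nu K @[nu --> F] --> m K.
Hypothesis m_le : forall K, closed K -> m K <= prb mu K.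

(** Cut [(n + 1) g] into [n + 1] slices. The slice [phi j] lies between the indicators of the closed
    superlevel sets [L (j + 1)] and [L j], so sums of masses of these sets determine the expectation
    up to [1], which is negligible after division by [n + 1]. *)
Lemma expect_unit_limit_le g (l : R) : continuous g -> (forall x, 0 <= g x <= 1) ->
  expect nu g @[nu --> F] --> l -> l <= expect mu g.
Proof.
move=> cg g01 Fl.
suff H n : n.+1%:R * l <= 1 + n.+1%:R * expect mu g.
  apply/ler_addgt0Pr => e e0.
  have [n _ /(_ n (leqnn n)) /= ne] := near_infty_natSinv_lt (PosNum e0).
  have n0 : 0 < n.+1%:R :> R by [].
  rewrite -(ler_pM2l n0); apply: le_trans (H n) _.
  by rewrite mulrDr addrC lerD2l -ler_pdivrMl// mulr1 ltW.
pose ng x := n.+1%:R * g x.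
have cng : continuous ng by move=> x; apply: cvgM; [exact: cvg_cst|exact: cg].
pose phi (j : nat) x := clamp (ng x - j%:R).
have cphi j : continuous (phi j).
  move=> x; apply: (@continuous_comp _ _ _ (fun x => ng x - j%:R) clamp).
    by apply: cvgB; [exact: cng|exact: cvg_cst].
  exact: clamp_continuous.
have phiE x : ng x = \sum_(j < n.+1) phi j x.
  have /andP[g0 g1] := g01 x.
  by rewrite sum_clamp ?mulr_ge0// min_l// /ng ler_piMr.
pose L (j : nat) := [set x | j%:R <= ng x].
have Lc j : closed (L j).
  by apply: (@closed_comp _ _ ng [set y | j%:R <= y]) => // x _; exact: cng.
have mL j := closed_borel (Lc j).
have ngE nu : n.+1%:R * expect nu g = \sum_(j < n.+1) expect nu (phi j).
  rewrite -expectZ// -(expect_sum _ _ cphi); congr expect.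
  by apply/funext => x; rewrite -phiE.
have up nu : n.+1%:R * expect nu g <= \sum_(j < n.+1) prb nu (L j).
  rewrite ngE; apply: ler_sum => j _; apply: expect_le_prb => //.
    by move=> x; exact: clamp_itv.
  move=> x /negP; rewrite /L /= -ltNge => h.
  by rewrite /phi /clamp max_l// ge_min subr_le0 (ltW h) orbT.
have lo : \sum_(j < n.+1) prb mu (L j) <= 1 + n.+1%:R * expect mu g.
  (* The slices are compared with superlevel sets shifted by one index; the set [L 0] left over
     accounts for the summand [1]. *)
  rewrite big_ord_recl; apply: lerD; first exact: prb_le1.
  rewrite ngE big_ord_recr /= -[leLHS]addr0; apply: lerD.
    apply: ler_sum => j _; apply: prb_le_expect => //.
      by move=> x; case/andP: (clamp_itv (ng x - j%:R)).
    move=> x; rewrite /L /= /bump leq0n add1n -natr1 => h.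
    by rewrite /phi /clamp le_max le_min lexx /= lerBrDl h orbT.
  rewrite -(expect_cst mu 0); apply: expect_le => //; first exact: cst_continuous.
  by move=> x; case/andP: (clamp_itv (ng x - n%:R)).
apply: le_trans lo; apply: (@le_trans _ _ (\sum_(j < n.+1) m (L j))).
  have c1 : n.+1%:R * expect nu g @[nu --> F] --> n.+1%:R * l.
    by apply: cvgM; [exact: cvg_cst|exact: Fl].
  have c2 : (\sum_(j < n.+1) prb nu (L j)) @[nu --> F] --> \sum_(j < n.+1) m (L j).
    by apply: (@cvg_sum_ord _ F (fun j nu => prb nu (L j)) (fun j => m (L j))) => j; exact: Fm.
  by apply: (@ler_cvg_to wstar F FF R _ _ _ _ c1 c2); apply: nearW => nu; exact: up.
by apply: ler_sum => j _; exact: m_le.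
Qed.

Lemma expect_limit_le f (l : R) : continuous f ->
  expect nu f @[nu --> F] --> l -> l <= expect mu f.
Proof.
move=> cf Fl; have [M M0 fM] := compact_continuous_bounded X_compact cf.
(* The [+ 1] keeps the scaling factor positive when [M = 0]. *)
pose c := (2 * M + 1)^-1.
have c0 : 0 < c by rewrite invr_gt0; lra.
pose g x := c * (f x + M).
have cfM : continuous (fun x => f x + M).
  by move=> x; apply: cvgD; [exact: cf|exact: cvg_cst].
have cg : continuous g by move=> x; apply: cvgM; [exact: cvg_cst|exact: cfM].
have gE nu : expect nu g = c * (expect nu f + M).
  by rewrite expectZ// expectD ?expect_cst//; exact: cst_continuous.
have : c * (l + M) <= expect mu g.
  apply: expect_unit_limit_le => //.
    move=> x; have := fM x; rewrite ler_norml => /andP[h1 h2].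
    apply/andP; split; first by rewrite /g pmulr_rge0//; lra.
    by rewrite /g mulrC ler_pdivrMr; lra.
  under eq_fun do rewrite gE.
  by apply: cvgM; [exact: cvg_cst|apply: cvgD => //; exact: cvg_cst].
by rewrite gE ler_pM2l// lerD2r.
Qed.

End LimitOfIntegrals.

Theorem weak_star_compact : compact [set: wstar].
Proof.
rewrite compact_ultra => F FU _; pose m K := lim (prb nu K @[nu --> F]).
have FF : ProperFilter F by case: FU.
have Fm K : closed K -> prb nu K @[nu --> F] --> m K.
  move=> Kc; have [] := @ultra_cvg _ F (fun nu => prb nu K) 0 1 FU.
    by move=> nu; rewrite prb_ge0 prb_le1//; exact: closed_borel.
  by move=> l h; apply/cvg_ex; exists l.
have m0 : m set0 = 0.
  rewrite /m; under [X in lim (X @ _)]eq_fun do rewrite prb_set0.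
  exact: lim_cst.
have mT : m setT = 1.
  rewrite /m; under [X in lim (X @ _)]eq_fun do rewrite prb_setT.
  exact: lim_cst.
have [mu muP] : exists mu : prob, forall K, closed K -> m K <= prb mu K.
  apply: content_extension => //.
  - move=> K L Kc Lc KL; apply: (@ler_cvg_to wstar F FF R _ _ _ _ (Fm _ Kc) (Fm _ Lc)).
    by apply: nearW => nu; apply: prb_le => //; exact: closed_borel.
  - move=> K L Kc Lc.
    apply: (@ler_cvg_to wstar F FF R _ _ _ _ (Fm _ (closedU Kc Lc)) (cvgD (Fm _ Kc) (Fm _ Lc))).
    by apply: nearW => nu; apply: prb_setUle => //; exact: closed_borel.
  - move=> K L Kc Lc KL; apply: (cvg_unique _ (Fm _ (closedU Kc Lc))) => //.
    rewrite (_ : (fun nu => _) = (fun nu => prb nu K + prb nu L)).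
      by apply: cvgD; exact: Fm.
    by apply/funext => nu; apply: prb_setU => //; exact: closed_borel.
exists mu; split => //; apply: weak_star_cvg => f.
have cf : continuous f by exact: cts_fun.
have [M M0 fM] := compact_continuous_bounded X_compact cf.
have [nu|l Fl] := @ultra_cvg _ F (fun nu => expect nu f) (- M) M FU.
  rewrite -{1}(expect_cst nu (- M)) -{2}(expect_cst nu M).
  by apply/andP; split; apply: expect_le => //; try exact: cst_continuous;
    move=> x; have := fM x; rewrite ler_norml => /andP[].
suff -> : expect mu f = l by [].
(* The comparison of [m] with [mu] is one-sided, so the converse inequality comes from [- f]. *)
apply/eqP; rewrite eq_le (expect_limit_le FF Fm muP cf Fl) andbT.
have cNf : continuous (fun x => -1 * f x).
  by move=> x; apply: cvgM; [exact: cvg_cst|exact: cf].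
rewrite -lerN2 -mulN1r -[leRHS]mulN1r -expectZ//.
apply: (expect_limit_le FF Fm muP cNf).
under eq_fun do rewrite expectZ//.
by apply: cvgM; [exact: cvg_cst|exact: Fl].
Qed.

End WeakStarCompact.

(** * Pushforwards and mixtures *)

Section ProbabilityConstructions.
Context {R : realType} {X : pointedMetricType R}.
Hypothesis X_compact : compact [set: X].
Local Notation prob := (probability (borelType X) R).
Local Notation wstar := (@weak_star R X).
Local Notation mble A := (measurable (A : set (borelType X))).
Implicit Types (mu nu : prob) (f g : X -> R).

(** Regularity and Urysohn functions compare the two measures on open sets, which are stable under
    intersection and generate the Borel sets. *)
Lemma prb_unique mu nu : (forall f, continuous f -> expect mu f = expect nu f) ->
  forall A, mble A -> mu A = nu A.
Proof.
have le (p q : prob) O : (forall f, continuous f -> expect p f = expect q f) ->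
    open O -> prb p O <= prb q O.
  move=> pq Oo; have mO := open_borel Oo; apply/ler_addgt0Pr => e e0.
  have [K [W [Kc Wo KO OW KWe]]] := borel_regular p mO e0.
  have mK := closed_borel Kc.
  have pK : prb p O - e <= prb p K.
    have : prb p (O `\` K) <= prb p (W `\` K).
      apply: prb_le; last by move=> x [/OW].
        exact: measurableD.
      by apply: measurableD => //; exact: open_borel.
    by rewrite prb_setD//; lra.
  have [f [cf f01 fK fO]] := urysohn_between X_compact Kc Oo KO.
  have h1 : prb p K <= expect p f.
    apply: prb_le_expect => //; first by move=> x; case/andP: (f01 x).
    by move=> x /fK ->.
  have h2 : expect q f <= prb q O by apply: expect_le_prb.
  by rewrite (pq _ cf) in h1; lra.
move=> pq A mA.
apply: (@g_sigma_algebra_measure_unique _ R (borelType X) open _ (fun=> setT) _ _ mu nu) => //.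
- by move=> B; exact: open_borel.
- by move=> _; exact: openT.
- by apply/seteqP; split=> // x _; exists 0%N.
- by move=> B C; exact: openI.
- move=> B Bo; apply: etrans (prbE mu (open_borel Bo)) _.
  apply: etrans _ (esym (prbE nu (open_borel Bo))).
  congr (_%:E); apply/eqP; rewrite eq_le.
  by apply/andP; split; apply: le => // f cf; rewrite pq.
- by move=> n; apply: (le_lt_trans (probability_le1 mu measurableT)); rewrite ltry.
Qed.

Lemma pushforward_prob mu (T : X -> X) : continuous T ->
  exists nu : prob, forall A, nu A = mu (T @^-1` A).
Proof.
move=> cT.
pose T' : {mfun borelType X >-> borelType X} :=
  HB.pack (T : borelType X -> borelType X)
    (isMeasurableFun.Build _ _ _ _ _ (continuous_map_borel cT)).
by exists (distribution mu T' : prob).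
Qed.

Lemma expect_pushforward mu nu (T : X -> X) f : continuous T ->
  (forall A, mble A -> nu A = mu (T @^-1` A)) -> continuous f ->
  expect nu f = expect mu (f \o T).
Proof.
move=> cT nuT cf; rewrite /expect /Rintegral; congr fine.
have mT := continuous_map_borel cT.
pose T' : {mfun borelType X >-> borelType X} :=
  HB.pack (T : borelType X -> borelType X) (isMeasurableFun.Build _ _ _ _ _ mT).
transitivity (\int[pushforward mu T']_(x in [set: borelType X]) (f x)%:E)%E.
  by apply: eq_measure_integral => A mA _; exact: nuT.
have cfT : continuous (f \o T) by move=> x; apply: continuous_comp; [exact: cT|exact: cf].
rewrite (@integral_pushforward _ _ _ _ _ T' mT mu setT (EFin \o f))//.
- by apply/measurable_EFinP; exact: continuous_borel.
- by rewrite preimage_setT; exact: continuous_integrable.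
Qed.

Lemma invariant_prob_expect mu (T : X -> X) : continuous T ->
  (forall f, continuous f -> expect mu (f \o T) = expect mu f) ->
  invariant_prob T mu.
Proof.
move=> cT muT A mA; have [nu nuE] := pushforward_prob mu cT.
rewrite -nuE; apply: prb_unique => // f cf.
by rewrite (@expect_pushforward mu nu T f cT _ cf) ?muT.
Qed.

Lemma mixture_prob (I : finType) (w : I -> R) (p : I -> prob) :
  (forall i, 0 <= w i) -> \sum_i w i = 1 ->
  exists mu : prob, (forall A, mble A -> prb mu A = \sum_i w i * prb (p i) A) /\
    (forall f, continuous f -> expect mu f = \sum_i w i * expect (p i) f).
Proof.
move=> w0 w1.
pose ms : seq {measure set (borelType X) -> \bar R} :=
  [seq (mscale (NngNum (w0 i)) (p i) : {measure set (borelType X) -> \bar R}) | i <- enum I].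
pose z : {measure set (borelType X) -> \bar R} := mzero.
pose m k := nth z ms k.
pose M : {measure set (borelType X) -> \bar R} := msum m (size ms).
have ME A : mble A -> M A = (\sum_i w i * prb (p i) A)%:E.
  move=> mA; rewrite /M /= /msum -(big_mkord xpredT (fun k => m k A)).
  rewrite -(big_nth z xpredT (fun q => q A)) big_map big_enum -sumEFin.
  by apply: eq_bigr => i _; rewrite EFinM /= /mscale; congr (_ * _)%E; exact: prbE.
have M1 : M setT = 1%E.
  rewrite ME//; under eq_bigr do rewrite prb_setT mulr1.
  by rewrite w1.
(* [M] already has mass [1]; normalising only gives it the structure of a probability, and the Dirac
   measure is a dummy. *)
pose mu : prob := mnormalize M (dirac point : prob).
have muE A : mu A = M A.
  by rewrite /mu /= /mnormalize M1 onee_eq0/= invr1 mule1.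
exists mu; split=> [A mA|f cf]; first by rewrite /prb muE ME.
have pos g : continuous g -> (forall x, 0 <= g x) ->
    expect mu g = \sum_i w i * expect (p i) g.
  move=> cg g0; apply: EFin_inj; rewrite -expectE//.
  have mg : measurable_fun [set: borelType X] (EFin \o g : borelType X -> \bar R).
    by apply/measurable_EFinP; exact: continuous_borel.
  transitivity (\int[M]_(x in [set: borelType X]) (g x)%:E)%E.
    by apply: eq_measure_integral => A mA _; exact: muE.
  rewrite (@ge0_integral_measure_sum _ _ _ m setT measurableT (EFin \o g))//; last first.
    by move=> x _; rewrite lee_fin.
  rewrite -(big_mkord xpredT (fun k => \int[m k]_(x in [set: borelType X]) (g x)%:E)%E).
  rewrite -(big_nth z xpredT (fun q : {measure set (borelType X) -> \bar R} =>
    \int[q]_(x in [set: borelType X]) (g x)%:E)%E) big_map big_enum -sumEFin.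
  apply: eq_bigr => i _.
  rewrite ge0_integral_mscale//=; last by move=> x _; rewrite lee_fin.
  by rewrite EFinM; congr (_ * _)%E; exact: (expectE X_compact).
(* Adding the constant [C] reduces to nonnegative functions, for which the integral against a sum of
   measures splits. *)
have [C C0 fC] := compact_continuous_bounded X_compact cf.
have cC : continuous (fun _ : X => C) by exact: cst_continuous.
have cfC : continuous (fun x => f x + C) by move=> x; apply: cvgD; [exact: cf|exact: cC].
have := pos _ cfC; rewrite expectD// expect_cst => h.
have {}h : expect mu f + C = \sum_i w i * expect (p i) f + C.
  rewrite h; last by move=> x; have := fC x; rewrite ler_norml; lra.
  under eq_bigr do rewrite expectD// expect_cst mulrDr.
  by rewrite big_split /= -mulr_suml w1 mul1r.
exact: addIr h.
Qed.

End ProbabilityConstructions.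

(** * Entropy of covers *)

Section FiniteFamilies.
Context {R : realType} {X : pointedMetricType R}.
Local Notation mble A := (measurable (A : set (borelType X))).

Lemma finite_set_enum (C : set (set X)) : finite_set C ->
  exists k (F : 'I_k -> set X), [/\ injective F, C = range F &
    forall g : set X -> R, \sum_(V \in C) g V = \sum_(i < k) g (F i)].
Proof.
move=> /finite_seqP[s0 CE]; pose s := undup s0.
have us : uniq s by exact: undup_uniq.
have sC V : (V \in s) = (V \in C) by rewrite mem_undup CE mem_setE.
exists (size s), (tnth (in_tuple s)); split.
- move=> i j; rewrite !(tnth_nth set0) /= => /eqP.
  by rewrite nth_uniq// => /eqP/val_inj.
- apply/seteqP; split=> [V CV|_ [i _ <-]].
    have /tnthP[i ->] : V \in in_tuple s by rewrite sC inE.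
    by exists i.
  by have := mem_tnth i (in_tuple s); rewrite sC inE.
- move=> g; have -> : C = [set` s].
    by apply/seteqP; split => V; rewrite /= sC inE.
  by rewrite -fsbig_seq// [LHS]big_tnth.
Qed.

(** Not an equality: a set repeated in the family [F] is counted once on the left. *)
Lemma sum_range_le (I : finType) (F : I -> set X) (g : set X -> R) :
  (forall i, 0 <= g (F i)) -> \sum_(V \in range F) g V <= \sum_i g (F i).
Proof.
move=> g0; have [|k [G [Ginj rG ->]]] := @finite_set_enum (range F).
  exact: finite_image.
have /choice[h hG] a : exists i, F i = G a.
  have : range G (G a) by exists a.
  by rewrite -rG => -[i _ <-]; exists i.
have hinj : injective h by move=> a b hab; apply: Ginj; rewrite -!hG hab.
under eq_bigr do rewrite -hG.
have -> : \sum_a g (F (h a)) = \sum_(i <- [seq h a | a <- enum 'I_k]) g (F i).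
  by rewrite big_map big_enum.
rewrite big_uniq/=; last by rewrite map_inj_uniq// enum_uniq.
rewrite [leRHS](bigID (mem [seq h i | i <- enum 'I_k]))/= lerDl.
by apply: sumr_ge0.
Qed.

(** Finite partitions are handled as maps to a finite type whose fibers are the elements. Joins
    become pairs, preimages become compositions, and empty fibers are harmless. *)
Definition measurable_label (J : finType) (phi : X -> J) : Prop :=
  forall j, mble (phi @^-1` [set j]).

Lemma measurable_label_pair (J K : finType) (phi : X -> J) (psi : X -> K) :
  measurable_label phi -> measurable_label psi ->
  measurable_label (fun x => (phi x, psi x)).
Proof.
move=> mphi mpsi [j k].
have -> : (fun x => (phi x, psi x)) @^-1` [set (j, k)] =
    phi @^-1` [set j] `&` psi @^-1` [set k].
  by apply/seteqP; split => x /=; [case=> -> ->|case=> -> ->].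
exact: measurableI.
Qed.

Lemma measurable_label_comp (J : finType) (phi : X -> J) (S : X -> X) :
  continuous S -> measurable_label phi -> measurable_label (phi \o S).
Proof. by move=> cS mphi j; exact: (preimage_borel cS (mphi j)). Qed.

Lemma first_index_label k (F : 'I_k -> set X) : (forall i, mble (F i)) ->
  (forall x, exists i, F i x) ->
  exists2 phi : X -> 'I_k, measurable_label phi & forall x, F (phi x) x.
Proof.
move=> mF Fcov.
have /choice[phi phiP] x : exists i, F i x /\ forall j : 'I_k, (j < i)%N -> ~ F j x.
  have [i0 Fi0] := Fcov x.
  have [i /asboolP Fi imin] := @arg_minnP _ i0 (fun i => `[< F i x >]) val (asboolT Fi0).
  exists i; split => // j ji Fj; have := imin j (asboolT Fj).
  by rewrite leqNgt ji.
exists phi; last by move=> x; have [] := phiP x.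
move=> j.
have -> : phi @^-1` [set j] = F j `\` \bigcup_(i in [set i : 'I_k | (i < j)%N]) F i.
  apply/seteqP; split => x /=.
    move=> <-; have [Fx nF] := phiP x; split=> // -[i /= ij Fi].
    exact: nF ij Fi.
  move=> [Fj nF]; have [Fx nFx] := phiP x; apply/val_inj => /=.
  case: (ltngtP (phi x) j) => // h; last by case: (nFx _ h).
  by case: nF; exists (phi x).
by apply: measurableD => //; apply: fin_bigcup_measurable.
Qed.

End FiniteFamilies.

Section LabelEntropy.
Context {R : realType} {X : pointedMetricType R}.
Local Notation prob := (probability (borelType X) R).
Local Notation mble A := (measurable (A : set (borelType X))).
Implicit Types (mu nu : prob).

Definition label_prb mu (J : finType) (phi : X -> J) (j : J) : R :=
  prb mu (phi @^-1` [set j]).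

Definition label_entropy mu (J : finType) (phi : X -> J) : R :=
  \sum_j ent_fun (label_prb mu phi j).

Lemma label_prb_ge0 mu (J : finType) (phi : X -> J) j : 0 <= label_prb mu phi j.
Proof. exact: prb_ge0. Qed.

Lemma label_prb_sum mu (J : finType) (phi : X -> J) : measurable_label phi ->
  \sum_j label_prb mu phi j = 1.
Proof.
move=> mphi; rewrite -(prb_setT mu) -(prb_fibers mu mphi measurableT).
by apply: eq_bigr => j _; rewrite setTI.
Qed.

Lemma label_entropy_ge0 mu (J : finType) (phi : X -> J) :
  measurable_label phi -> 0 <= label_entropy mu phi.
Proof.
move=> mphi; apply: sumr_ge0 => j _; apply: ent_fun_ge0.
by rewrite prb_ge0 prb_le1.
Qed.

Lemma label_entropy_gibbs mu (J : finType) (phi : X -> J) (q : J -> R) :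
  measurable_label phi -> (forall j, 0 <= q j) -> \sum_j q j <= 1 ->
  (forall j, q j = 0 -> label_prb mu phi j = 0) ->
  label_entropy mu phi <= \sum_j - (label_prb mu phi j * ln (q j)).
Proof.
move=> mphi q0 q1 qp.
apply: (@le_trans _ _ (\sum_j (- (label_prb mu phi j * ln (q j)) + q j - label_prb mu phi j))).
  by apply: ler_sum => j _; apply: gibbs; [exact: label_prb_ge0|exact: q0|exact: qp].
by rewrite sumrB label_prb_sum// big_split /=; lra.
Qed.

Lemma label_entropy_card mu (J : finType) (phi : X -> J) : measurable_label phi ->
  label_entropy mu phi <= ln #|J|%:R.
Proof.
move=> mphi; have j0 := phi point.
have J0 : 0 < #|J|%:R :> R by rewrite ltr0n; apply/card_gt0P; exists j0.
have s1 : \sum_(j : J) (#|J|%:R^-1 : R) = 1.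
  by rewrite sumr_const -[LHS]mulr_natr mulVf// gt_eqF.
apply: le_trans (@label_entropy_gibbs mu J phi (fun=> #|J|%:R^-1) mphi _ _ _) _ => //.
- by rewrite s1.
- by move=> j /eqP; rewrite invr_eq0 gt_eqF.
- under eq_bigr do rewrite lnV ?posrE// mulrN opprK.
  by rewrite -mulr_suml label_prb_sum// mul1r.
Qed.

(** Gibbs' inequality against the product of the two marginals. The second marginal is taken for the
    pushforward [nu], as [mu] is not assumed invariant. *)
Lemma label_entropy_pair mu nu (J K : finType) (phi : X -> J) (psi : X -> K) (S : X -> X) :
  continuous S -> (forall A, mble A -> nu A = mu (S @^-1` A)) ->
  measurable_label phi -> measurable_label psi ->
  label_entropy mu (fun x => (phi x, psi (S x))) <=
  label_entropy mu phi + label_entropy nu psi.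
Proof.
move=> cS nuS mphi mpsi; set chi := fun x => _.
have mpsiS := measurable_label_comp cS mpsi.
have mchi : measurable_label chi by exact: measurable_label_pair.
pose p := label_prb mu phi; pose q := label_prb nu psi.
have qE k : q k = label_prb mu (psi \o S) k.
  by rewrite /q /label_prb /prb nuS.
have chiE j k : label_prb mu chi (j, k) =
    prb mu (phi @^-1` [set j] `&` (psi \o S) @^-1` [set k]).
  by congr prb; apply/seteqP; split => x; rewrite /chi /=; [case=> <- <-|case=> <- <-].
have sumk j : \sum_k label_prb mu chi (j, k) = p j.
  rewrite /p /label_prb -(prb_fibers mu mpsiS (mphi j)).
  by apply: eq_bigr => k _; rewrite -chiE.
have sumj k : \sum_j label_prb mu chi (j, k) = q k.
  rewrite qE /label_prb -(prb_fibers mu mphi (mpsiS k)).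
  by apply: eq_bigr => j _; rewrite setIC -chiE.
have chip j k : label_prb mu chi (j, k) <= p j.
  rewrite chiE; apply: prb_le; [|exact: mphi|by move=> x []].
  by apply: measurableI; [exact: mphi|exact: mpsiS].
have chiq j k : label_prb mu chi (j, k) <= q k.
  rewrite chiE qE; apply: prb_le; [|exact: mpsiS|by move=> x []].
  by apply: measurableI; [exact: mphi|exact: mpsiS].
have p1 : \sum_j p j = 1 by exact: label_prb_sum.
have q1 : \sum_k q k = 1 by exact: label_prb_sum.
have chi0 jk : 0 <= label_prb mu chi jk by exact: label_prb_ge0.
apply: le_trans (@label_entropy_gibbs mu _ chi (fun jk => p jk.1 * q jk.2) mchi _ _ _) _.
- by move=> jk; rewrite mulr_ge0// label_prb_ge0.
- rewrite -(pair_bigA _ (fun j k => p j * q k))/=.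
  by under eq_bigr do rewrite -mulr_sumr q1 mulr1; rewrite p1.
- move=> [j k] /= /eqP; rewrite mulf_eq0 => /orP[/eqP h|/eqP h].
    by apply/eqP; rewrite eq_le chi0 andbT -h chip.
  by apply/eqP; rewrite eq_le chi0 andbT -h chiq.
rewrite (eq_bigr (fun jk => - (label_prb mu chi (jk.1, jk.2) * ln (p jk.1)) +
   - (label_prb mu chi (jk.1, jk.2) * ln (q jk.2)))); last first.
  (* The logarithm of the product splits only where both marginals are positive; elsewhere the term
     vanishes. *)
  move=> [j k] _ /=; have [->|n0] := eqVneq (label_prb mu chi (j, k)) 0.
    by rewrite !mul0r oppr0 addr0.
  have c0 : 0 < label_prb mu chi (j, k) by rewrite lt_neqAle eq_sym n0 chi0.
  rewrite lnM ?posrE; first by ring.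
    exact: lt_le_trans c0 (chip j k).
  exact: lt_le_trans c0 (chiq j k).
rewrite big_split /= lerD//.
  rewrite -(pair_bigA _ (fun j k => - (label_prb mu chi (j, k) * ln (p j))))/=.
  apply: ler_sum => j _; rewrite -(big_morph _ (@opprD R) (@oppr0 R)).
  by rewrite -mulr_suml sumk /ent_fun.
rewrite -(pair_bigA _ (fun j k => - (label_prb mu chi (j, k) * ln (q k))))/= exchange_big/=.
apply: ler_sum => k _; rewrite -(big_morph _ (@opprD R) (@oppr0 R)).
by rewrite -mulr_suml sumj /ent_fun.
Qed.

(** For each label, [gibbs] puts all values of [ent_fun] below its tangent line at the averaged mass
    [q]; in the weighted mean the terms [q - p] cancel. *)
Lemma label_entropy_concave (I : finType) (w : I -> R) (p : I -> prob) mu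
    (J : finType) (phi : X -> J) : measurable_label phi ->
  (forall i, 0 <= w i) -> \sum_i w i = 1 ->
  (forall A, mble A -> prb mu A = \sum_i w i * prb (p i) A) ->
  \sum_i w i * label_entropy (p i) phi <= label_entropy mu phi.
Proof.
move=> mphi w0 w1 muE.
under eq_bigr do rewrite mulr_sumr.
rewrite exchange_big /=; apply: ler_sum => j _.
pose q := label_prb mu phi j.
have qE : q = \sum_i w i * label_prb (p i) phi j by exact: muE.
have t0 i : 0 <= w i * label_prb (p i) phi j by rewrite mulr_ge0// label_prb_ge0.
apply: (@le_trans _ _ (\sum_i w i * (- (label_prb (p i) phi j * ln q) + q - label_prb (p i) phi j))).
  apply: ler_sum => i _; have [->|wi] := eqVneq (w i) 0; first by rewrite !mul0r.
  rewrite ler_wpM2l// gibbs ?label_prb_ge0// => q0.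
  have := qE; rewrite q0 => /esym/eqP; rewrite psumr_eq0// => /allP /(_ i).
  by rewrite mem_index_enum => /(_ isT) /=; rewrite mulf_eq0 (negbTE wi) /= => /eqP.
rewrite (eq_bigr (fun i => - (w i * label_prb (p i) phi j) * ln q + w i * q -
   w i * label_prb (p i) phi j)); last by move=> i _; ring.
rewrite sumrB big_split /= -!mulr_suml w1 mul1r.
by rewrite sumrN -qE /ent_fun -/q; lra.
Qed.

Lemma label_entropy_lower mu (J : finType) (phi : X -> J) (t : R) :
  measurable_label phi -> 0 < t -> (forall j, label_prb mu phi j <= t) ->
  - ln t <= label_entropy mu phi.
Proof.
move=> mphi t0 pt.
have -> : - ln t = \sum_j - (label_prb mu phi j * ln t).
  by rewrite sumrN -mulr_suml label_prb_sum// mul1r.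
apply: ler_sum => j _; rewrite /ent_fun lerN2.
have [->|n0] := eqVneq (label_prb mu phi j) 0; first by rewrite !mul0r.
have p0 : 0 < label_prb mu phi j by rewrite lt_neqAle eq_sym n0 label_prb_ge0.
by rewrite ler_pM2l// ler_ln ?posrE.
Qed.

End LabelEntropy.

(** * Entropy of iterated covers through cylinders and labels *)

Section IteratedCovers.
Context {R : realType} {X : pointedMetricType R}.
Hypothesis X_compact : compact [set: X].
Variables (T : X -> X) (d : nat) (u : 'I_d -> set X).
Hypothesis T_cont : continuous T.
Hypothesis u_open : forall i, open (u i).
Hypothesis u_cover : forall x, exists i, u i x.
Local Notation prob := (probability (borelType X) R).
Local Notation wstar := (@weak_star R X).
Local Notation mble A := (measurable (A : set (borelType X))).
Implicit Types (mu nu : prob).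

(* Words are indexed by [nat] rather than ['I_n], only their first [n] letters
   being relevant, which spares casts when words are shifted. *)
Definition cylinder (n : nat) (w : nat -> 'I_d) : set X :=
  [set x | forall i, (i < n)%N -> u (w i) (iter i T x)].

(** Generalised to a starting time [k], because the induction splits off the first letter and so
    moves along the orbit. *)
Let iter_cover_shift n : forall k,
  \big[cover_join/[set [set: X]]]_(i < n) cover_preimage (iter (k + i) T) (range u) =
  range (fun (w : nat -> 'I_d) => [set x | forall i, (i < n)%N -> u (w i) (iter (k + i) T x)]).
Proof.
have [d0 _] := u_cover point.
elim: n => [|n IH] k.
  rewrite big_ord0; apply/seteqP; split => [_ ->|_ [w _ <-]].
    by exists (fun=> d0) => //; apply/seteqP; split.
  by apply/seteqP; split.
rewrite big_ord_recl /= addn0; under eq_bigr do rewrite /= /bump /= add1n addnS -addSn.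
rewrite IH; apply/seteqP; split.
  move=> _ [_ [_ [j _ <-] <-] [_ [w _ <-] <-]].
  exists (fun i => if i is i'.+1 then w i' else j) => //.
  apply/seteqP; split => x /=.
    move=> xw; split; first by have := xw 0%N isT; rewrite addn0.
    by move=> i il; have := xw i.+1 il; rewrite addnS -addSn.
  move=> [uj xw] [_|i il]; first by rewrite addn0.
  by rewrite addnS -addSn; exact: xw.
move=> _ [w _ <-]; exists (iter k T @^-1` u (w 0%N)).
  by exists (u (w 0%N)) => //; exists (w 0%N).
exists [set x | forall i, (i < n)%N -> u (w i.+1) (iter (k.+1 + i) T x)].
  by exists (fun i => w i.+1).
apply/seteqP; split => x /=.
  move=> [uj xw] [_|i il]; first by rewrite addn0.
  by rewrite addnS -addSn; exact: xw.
move=> xw; split; first by have := xw 0%N isT; rewrite addn0.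
by move=> i il; have := xw i.+1 il; rewrite addnS -addSn.
Qed.

Lemma iter_cover_cylinder n : iter_cover T (range u) n = range (cylinder n).
Proof. exact: (iter_cover_shift n 0). Qed.

Lemma cylinder_open n w : open (cylinder n w).
Proof.
elim: n => [|n IH].
  rewrite (_ : cylinder 0 w = setT); first exact: openT.
  by apply/seteqP; split.
rewrite (_ : cylinder n.+1 w = cylinder n w `&` iter n T @^-1` u (w n)).
  apply: openI => //.
  by apply: open_comp => // x _; exact: iter_continuous.
apply/seteqP; split => x /=.
  by move=> xw; split => [i ilt|]; apply: xw => //; exact: ltnW.
move=> [xw uj] i; rewrite ltnS leq_eqVlt => /orP[/eqP ->//|ilt].
exact: xw.
Qed.

Definition fine_label (n : nat) (J : finType) (phi : X -> J) : Prop :=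
  forall j, exists w, phi @^-1` [set j] `<=` cylinder n w.

Lemma fine_label_le n m (J : finType) (phi : X -> J) : (n <= m)%N ->
  fine_label m phi -> fine_label n phi.
Proof.
move=> nm h j; have [w wP] := h j; exists w => x /wP xw i il.
by apply: xw; exact: leq_trans nm.
Qed.

Lemma fine_label_pair n m (J K : finType) (phi : X -> J) (psi : X -> K) :
  fine_label n phi -> fine_label m psi ->
  fine_label (n + m) (fun x => (phi x, psi (iter n T x))).
Proof.
move=> hphi hpsi [j k]; have [w wP] := hphi j; have [v vP] := hpsi k.
exists (fun i => if (i < n)%N then w i else v (i - n)%N) => x /= -[xj xk] i il.
have [ilt|ige] := ltnP i n; first exact: wP.
have -> : iter i T x = iter (i - n) T (iter n T x) by rewrite -iterD subnK.
by apply: vP => //; lia.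
Qed.

Lemma letter_label : exists2 phi : X -> 'I_d, measurable_label phi & fine_label 1 phi.
Proof.
have [phi mphi phiP] := first_index_label (fun i => open_borel (u_open i)) u_cover.
exists phi => // j; exists (fun=> j) => x /= xj i; rewrite ltnS leqn0 => /eqP -> /=.
by rewrite -xj.
Qed.

Lemma word_label n : exists (J : finType) (phi : X -> J),
  [/\ measurable_label phi, fine_label n phi & #|J| = (d ^ n)%N].
Proof.
have [phi1 m1 f1] := letter_label.
elim: n => [|n [J [phi [mphi fphi cJ]]]].
  exists unit, (fun=> tt); split; last by rewrite card_unit expn0.
    move=> [] ; rewrite (_ : _ @^-1` _ = setT)//.
    by apply/seteqP; split.
  by move=> []; have [w _] := f1 (phi1 point); exists w.
exists (J * 'I_d)%type, (fun x => (phi x, phi1 (iter n T x))); split.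
- apply: measurable_label_pair => //.
  by apply: (measurable_label_comp _ m1); exact: iter_continuous.
- by rewrite -addn1; exact: fine_label_pair.
- by rewrite card_prod card_ord cJ expnSr.
Qed.

Definition word_entropy mu n : R := cover_entropy mu (iter_cover T (range u) n).

Let partition_entropy_ge0 mu (alpha : set (set X)) : is_partition (R := R) alpha ->
  0 <= partition_entropy mu alpha.
Proof.
move=> [[af am _] _]; rewrite /partition_entropy fsbig_finite//=.
rewrite big_seq; apply: sumr_ge0 => A; rewrite in_fset_set// inE => aA.
by apply: ent_fun_ge0; rewrite [fine _ in X in _ <= X]/(prb mu A) prb_ge0 prb_le1//; exact: am.
Qed.

Lemma fibers_partition (J : finType) (phi : X -> J) : measurable_label phi ->
  is_partition (R := R) (range (fun j => phi @^-1` [set j])).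
Proof.
move=> mphi; split; first split.
- exact: finite_image.
- by move=> _ [j _ <-]; exact: mphi.
- apply/seteqP; split => // x _; by exists (phi @^-1` [set phi x]).
- by move=> _ _ [i _ <-] [j _ <-] [x [/= <- <-]].
Qed.

Lemma fibers_finer n (J : finType) (phi : X -> J) : fine_label n phi ->
  finer (range (fun j => phi @^-1` [set j])) (iter_cover T (range u) n).
Proof.
move=> fphi _ [j _ <-]; have [w wP] := fphi j.
by exists (cylinder n w) => //; rewrite iter_cover_cylinder; exists w.
Qed.

Lemma word_entropy_le mu n (J : finType) (phi : X -> J) :
  measurable_label phi -> fine_label n phi -> word_entropy mu n <= label_entropy mu phi.
Proof.
move=> mphi fphi; pose alpha := range (fun j => phi @^-1` [set j]).
apply: (@le_trans _ _ (partition_entropy mu alpha)).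
  apply: ge_inf.
    by exists 0 => _ [b [pb _] <-]; exact: partition_entropy_ge0.
  by exists alpha => //; split; [exact: fibers_partition|exact: fibers_finer].
apply: (@sum_range_le R X J (fun j => phi @^-1` [set j])
  (fun A => - (fine (mu A) * ln (fine (mu A))))) => j.
by apply: ent_fun_ge0; rewrite [fine _ in X in _ <= X]/(prb mu _) prb_ge0 prb_le1.
Qed.

(** With [word_entropy_le], this replaces the infimum over partitions by one over labels: a
    partition is turned into the map naming the element that contains a point. *)
Lemma word_entropy_ge mu n (c : R) :
  (forall (J : finType) (phi : X -> J), measurable_label phi -> fine_label n phi ->
    c <= label_entropy mu phi) -> c <= word_entropy mu n.
Proof.
move=> h; have [J [phi [mphi fphi _]]] := word_label n.
apply: lb_le_inf.
  pose alpha := range (fun j => phi @^-1` [set j]).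
  exists (partition_entropy mu alpha), alpha => //.
  by split; [exact: fibers_partition|exact: fibers_finer].
move=> _ [alpha [[[af am aT] tr] afine] <-].
have [k [F [Finj aF sumF]]] := finite_set_enum af.
have /choice[psi psiP] x : exists i, F i x.
  have : (\bigcup_(V in alpha) V) x by rewrite aT.
  by rewrite aF => -[_ [i _ <-] Fx]; exists i.
have fib i : psi @^-1` [set i] = F i.
  apply/seteqP; split => x /=; first by move=> <-.
  move=> Fx; apply: Finj; apply: tr; rewrite ?aF; [by exists (psi x)|by exists i|].
  by exists x.
have mpsi : measurable_label psi.
  by move=> i; rewrite fib; apply: am; rewrite aF; exists i.
have fpsi : fine_label n psi.
  move=> i; have [|W WI FW] := afine (F i); first by rewrite aF; exists i.
  by move: WI; rewrite iter_cover_cylinder => -[w _ wW]; exists w; rewrite fib wW.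
apply: le_trans (h _ _ mpsi fpsi) _.
rewrite /partition_entropy sumF /label_entropy /label_prb.
by apply: ler_sum => i _; rewrite fib.
Qed.

Lemma word_entropy_approx mu n (e : R) : 0 < e -> exists (J : finType) (phi : X -> J),
  [/\ measurable_label phi, fine_label n phi & label_entropy mu phi < word_entropy mu n + e].
Proof.
move=> e0; apply: contrapT => nex.
suff : word_entropy mu n + e <= word_entropy mu n by lra.
apply: word_entropy_ge => J phi mphi fphi; rewrite leNgt; apply/negP => h.
by apply: nex; exists J, phi.
Qed.

Lemma word_entropy_ge0 mu n : 0 <= word_entropy mu n.
Proof. by apply: word_entropy_ge => J phi mphi _; exact: label_entropy_ge0. Qed.

Lemma word_entropy_mono mu n m : (n <= m)%N -> word_entropy mu n <= word_entropy mu m.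
Proof.
move=> nm; apply: word_entropy_ge => J phi mphi fphi.
by apply: word_entropy_le => //; exact: fine_label_le fphi.
Qed.

Lemma word_entropy_card mu n : word_entropy mu n <= n%:R * ln d%:R.
Proof.
have [J [phi [mphi fphi cJ]]] := word_label n.
have d0 : (0 < d)%N by have [i _] := u_cover point; case: d i => // -[].
apply: le_trans (word_entropy_le mu mphi fphi) _.
apply: le_trans (label_entropy_card mu mphi) _.
by rewrite cJ natrX lnXn ?ltr0n// mulr_natl.
Qed.

Lemma word_entropy0 mu : word_entropy mu 0 = 0.
Proof.
apply/eqP; rewrite eq_le word_entropy_ge0 andbT.
by have := word_entropy_card mu 0; rewrite mul0r.
Qed.

Lemma word_entropy_subadditive mu nu n m :
  (forall A, mble A -> nu A = mu (iter n T @^-1` A)) ->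
  word_entropy mu (n + m) <= word_entropy mu n + word_entropy nu m.
Proof.
move=> nuT; apply/ler_addgt0Pr => e e0.
have e2 : 0 < e / 2 by lra.
have [J [phi [mphi fphi hphi]]] := word_entropy_approx mu n e2.
have [K [psi [mpsi fpsi hpsi]]] := word_entropy_approx nu m e2.
have cS : continuous (iter n T) by exact: iter_continuous.
have := label_entropy_pair cS nuT mphi mpsi.
have : word_entropy mu (n + m) <= label_entropy mu (fun x => (phi x, psi (iter n T x))).
  apply: word_entropy_le; last exact: fine_label_pair.
  by apply: measurable_label_pair => //; exact: measurable_label_comp.
lra.
Qed.

Lemma word_entropy_concave (I : finType) (w : I -> R) (p : I -> prob) mu n :
  (forall i, 0 <= w i) -> \sum_i w i = 1 ->
  (forall A, mble A -> prb mu A = \sum_i w i * prb (p i) A) ->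
  \sum_i w i * word_entropy (p i) n <= word_entropy mu n.
Proof.
move=> w0 w1 muE; apply: word_entropy_ge => J phi mphi fphi.
apply: le_trans (label_entropy_concave mphi w0 w1 muE).
by apply: ler_sum => i _; rewrite ler_wpM2l// word_entropy_le.
Qed.

Lemma word_entropy_lower mu n (t : R) : 0 < t ->
  (forall w, prb mu (cylinder n w) <= t) -> - ln t <= word_entropy mu n.
Proof.
move=> t0 mut; apply: word_entropy_ge => J phi mphi fphi.
apply: label_entropy_lower => // j; have [w wP] := fphi j.
apply: le_trans (mut w); apply: prb_le => //.
by apply: open_borel; exact: cylinder_open.
Qed.

Lemma invariant_iter mu n : invariant_prob T mu ->
  forall A, mble A -> mu A = mu (iter n T @^-1` A).
Proof.
move=> inv; elim: n => [|n IH] A mA //=.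
rewrite (IH A mA) -inv; last exact: (preimage_borel (iter_continuous T_cont)).
by congr (mu _); apply/seteqP; split => x; rewrite /= -iterSr.
Qed.

Lemma entropy_cvg mu : invariant_prob T mu ->
  n%:R^-1 * word_entropy mu n @[n --> \oo] --> entropy T (range u) mu.
Proof.
move=> inv; apply: fekete => [n|n m]; first exact: word_entropy_ge0.
by apply: word_entropy_subadditive; exact: invariant_iter.
Qed.

(* Summing the subadditivity inequalities over the [N] offsets of a splitting
   of [0, n) into blocks of length [N] amounts to telescoping
   [\sum_(j < N) word_entropy (q (k + j)) (n - (k + j))] in [k]. *)
Lemma word_entropy_blocks (q : nat -> prob) n N : (0 < N)%N ->
  (forall k l A, mble A -> q (k + l)%N A = q k (iter l T @^-1` A)) ->
  N%:R * word_entropy (q 0%N) n <=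
    \sum_(k < n) word_entropy (q k) N + N%:R ^+ 2 * ln d%:R.
Proof.
move=> N0 qT; pose c k := word_entropy (q k) (n - k).
have lnd : 0 <= ln (d%:R : R).
  have d0 : (0 < d)%N by have [i _] := u_cover point; case: d i => // -[].
  by rewrite ln_ge0// ler1n.
(* Starting [j] steps later forgets [j] letters, each worth at most [ln d]. Summed over the offsets
   [j < N], with each [j] bounded by [N], this is the error [N^2 ln d]. *)
have c0 j : c 0%N <= c j + j%:R * ln d%:R.
  rewrite /c subn0; have [jn|nj] := leqP j n.
    rewrite -{1}(subnKC jn) addrC.
    apply: le_trans (word_entropy_subadditive _ _) _.
      by move=> A mA; exact: (qT 0%N j).
    by rewrite lerD2r word_entropy_card.
  apply: (@le_trans _ _ (j%:R * ln d%:R)); last by rewrite lerDr word_entropy_ge0.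
  apply: le_trans (word_entropy_card _ _) _; rewrite ler_wpM2r// ler_nat.
  exact: ltnW.
(* Near the end, [n - (k + N)] is truncated to [0] and one block covers all that is left. *)
have cstep k : c k <= word_entropy (q k) N + c (k + N)%N.
  have [kn|nk] := leqP (k + N) n.
    rewrite /c (_ : n - k = N + (n - (k + N)))%N; last by lia.
    by apply: word_entropy_subadditive => A mA; exact: qT.
  apply: (@le_trans _ _ (word_entropy (q k) N)); last by rewrite lerDl word_entropy_ge0.
  by apply: word_entropy_mono; lia.
pose S k := \sum_(j < N) c (k + j)%N.
have Sstep k : S k + c (k + N)%N = S k.+1 + c k.
  rewrite /S -(big_mkord xpredT (fun j => c (k + j)%N)) -(big_mkord xpredT (fun j => c (k.+1 + j)%N)).
  rewrite -(big_nat_recr N 0 (fun j => c (k + j)%N))//= big_nat_recl// addrC addn0.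
  by congr (_ + _); apply: eq_bigr => j _; rewrite addSnnS.
have Sbound m : S 0%N <= \sum_(k < m) word_entropy (q k) N + S m.
  elim: m => [|m IH]; first by rewrite big_ord0 add0r.
  apply: le_trans IH _; rewrite big_ord_recr /= -addrA lerD2l.
  by have := cstep m; have := Sstep m; lra.
have Sn : S n = 0.
  by rewrite /S big1// => j _; rewrite /c (_ : n - (n + j) = 0)%N ?word_entropy0//; lia.
have := Sbound n; rewrite Sn addr0 => h.
apply: le_trans (_ : S 0%N + N%:R ^+ 2 * ln d%:R <= _); last by rewrite lerD2r.
rewrite expr2 -mulrA [N%:R * word_entropy _ _]mulr_natl [N%:R * (_ * _)]mulr_natl.
have -> : word_entropy (q 0%N) n *+ N = \sum_(j < N) c 0%N.
  by rewrite sumr_const card_ord /c subn0.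
have -> : (N%:R * ln d%:R) *+ N = \sum_(j < N) (N%:R * ln d%:R : R).
  by rewrite sumr_const card_ord.
rewrite -big_split /=; apply: ler_sum => j _; rewrite add0n.
apply: le_trans (c0 j) _; rewrite lerD2l ler_wpM2r// ler_nat.
exact: ltnW.
Qed.

End IteratedCovers.

(** * Weak-star upper semicontinuity of cover entropy *)

Section UpperSemicontinuity.
Context {R : realType} {X : pointedMetricType R}.
Hypothesis X_compact : compact [set: X].
Local Notation prob := (probability (borelType X) R).
Local Notation wstar := (@weak_star R X).
Local Notation mble A := (measurable (A : set (borelType X))).
Implicit Types (mu nu : prob).

Lemma disjoint_open_family (J : finType) (K : J -> set X) :
  (forall j, closed (K j)) -> (forall i j, i != j -> K i `&` K j = set0) ->
  exists O : J -> set X, [/\ forall j, open (O j), forall j, K j `<=` O j &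
    forall i j x, O i x -> O j x -> i = j].
Proof.
move=> Kc Kd; pose L j := \bigcup_(i in [set i | i != j]) K i.
have Lc j : closed (L j) by apply: closed_bigcup => [|i _]; [exact: finite_finset|exact: Kc].
have nX : normal_space X by apply: compact_normal => //; exact: metric_hausdorff.
have /choice[AB ABP] j : exists AB : set X * set X,
    [/\ open AB.1, open AB.2, K j `<=` AB.1, L j `<=` AB.2 & AB.1 `&` AB.2 = set0].
  have [||A [B ABj]] := iffLR (@normal_openP R X) nX (K j) (L j) (Kc j).
  - exact: Lc.
  - apply/seteqP; split => // x [Kx [i /= ij Ki]].
    by have : (K i `&` K j) x by []; rewrite (Kd _ _ ij).
  by exists (A, B).
(* This is [A j] intersected with all [B i] for [i != j]; it misses [A i] because [A i] and [B i]
   are disjoint. *)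
exists (fun j => (AB j).1 `\` \bigcup_(i in [set i | i != j]) ~` (AB i).2); split.
- move=> j; rewrite setDE; apply: openI; first by have [] := ABP j.
  rewrite openC; apply: closed_bigcup => [|i _]; first exact: finite_finset.
  rewrite closedC.
  by have [] := ABP i.
- move=> j x Kx; split; first by have [_ _ + _ _] := ABP j; apply.
  move=> [i /= ij]; apply; have [_ _ _ + _] := ABP i; apply.
  by exists j => //=; rewrite eq_sym.
- move=> i j x [Ai _] [_ Bj]; apply/eqP/negPn/negP => ij.
  have [_ _ _ _ ABi] := ABP i.
  suff : ((AB i).1 `&` (AB i).2) x by rewrite ABi.
  by split=> //; apply: contrapT => nB; apply: Bj; exists i.
Qed.

Lemma finite_min_gt0 (J : finType) (f : J -> R) : (forall j, 0 < f j) ->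
  exists2 r, 0 < r & forall j, r <= f j.
Proof.
move=> f0; exists (\big[Num.min/1]_j f j); first by apply/lt_bigmin.
by move=> j; apply: bigmin_le_cond.
Qed.

(** The boundaries of the fibers of [phi] may carry mass, so [phi] itself is modified. Its fibers
    are shrunk to closed sets, which are thickened to disjoint open sets [O j] inside [V j], and
    [psi] is [j] on [O j] and [phi] elsewhere. Masses of open sets are lower semicontinuous, and the
    [O j] carry almost all the mass of [mu]. *)
Lemma label_entropy_usc mu (J : finType) (phi : X -> J) (V : J -> set X) (e : R) :
  measurable_label phi -> (forall j, open (V j)) ->
  (forall j, phi @^-1` [set j] `<=` V j) -> 0 < e ->
  exists psi : X -> J, [/\ measurable_label psi, forall j, psi @^-1` [set j] `<=` V j &
    \forall nu \near (mu : wstar), label_entropy nu psi <= label_entropy mu phi + e].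
Proof.
move=> mphi Vo phiV e0; pose p := label_prb mu phi.
have m0 : 0 < #|J|%:R :> R.
  by rewrite ltr0n; apply/card_gt0P; exists (phi point).
have em0 : 0 < e / #|J|%:R by rewrite divr_gt0.
have /choice[dl dlP] j : exists d : R, 0 < d /\
    forall q, 0 <= q -> `|q - p j| <= d -> ent_fun q <= ent_fun (p j) + e / #|J|%:R.
  by have [d d0 dP] := ent_fun_upper_continuous (label_prb_ge0 mu phi j) em0; exists d.
have [del del0 delP] := @finite_min_gt0 J dl (fun j => (dlP j).1).
(* A fiber loses at most [r] in passing to [K j] and [r] in passing to [nu]; together the losses of
   all fibers are at most [del]. *)
pose r := del / (2 * #|J|%:R).
have r0 : 0 < r by rewrite divr_gt0// mulr_gt0.
have rE : 2 * r * #|J|%:R = del.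
  by rewrite /r -mulrA mulrAC mulrA; field; rewrite gt_eqF.
have /choice[K KP] j : exists K, [/\ closed K, K `<=` phi @^-1` [set j] & p j - r < prb mu K].
  have [K [W [Kc Wo KA AW KW]]] := borel_regular mu (mphi j) r0.
  exists K; split => //.
  have : prb mu (phi @^-1` [set j] `\` K) <= prb mu (W `\` K).
    apply: prb_le; last by move=> x [/AW].
      by apply: measurableD; [exact: mphi|exact: closed_borel].
    by apply: measurableD; [exact: open_borel|exact: closed_borel].
  rewrite prb_setD//; last exact: closed_borel.
  by rewrite -/(label_prb mu phi j) -/(p j); lra.
have [|i j ij|G [Go KG Gd]] := @disjoint_open_family J K.
- by move=> j; have [] := KP j.
- apply/seteqP; split => // x [Ki Kj]; have [_ /(_ _ Ki) /= xi _] := KP i.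
  have [_ /(_ _ Kj) /= xj _] := KP j.
  by move: ij; rewrite -xi -xj eqxx.
pose O j := G j `&` V j.
have Oo j : open (O j) by exact: openI.
have KO j : K j `<=` O j.
  by have [_ Kphi _] := KP j; move=> x Kx; split; [exact: KG|exact: phiV (Kphi _ Kx)].
have Od i j x : O i x -> O j x -> i = j by move=> [+ _] [+ _]; exact: Gd.
pose psi x := if [pick j | `[< O j x >]] is Some j then j else phi x.
have psiO j x : O j x -> psi x = j.
  rewrite /psi; case: pickP => [i /asboolP Oi Oj|h Oj]; first exact: Od Oi Oj.
  by have := h j; rewrite asboolT.
have psiN x : (forall j, ~ O j x) -> psi x = phi x.
  by rewrite /psi; case: pickP => [i /asboolP Oi h|//]; case: (h i).
have psiE j : psi @^-1` [set j] = O j `|` (phi @^-1` [set j] `\` \bigcup_(i in setT) O i).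
  apply/seteqP; split => x /=.
    have [[i Oi]|nO] := pselect (exists i, O i x).
      by rewrite (psiO _ _ Oi) => <-; left.
    have nO2 i : ~ O i x by move=> Oi; apply: nO; exists i.
    by rewrite (psiN _ nO2) => xj; right; split=> // -[i _ /nO2].
  move=> [|[xj nO]]; first exact: psiO.
  by rewrite psiN// => i Oi; apply: nO; exists i.
have mpsi : measurable_label psi.
  move=> j; rewrite psiE; apply: measurableU; first exact: open_borel.
  apply: measurableD; first exact: mphi.
  by apply: open_borel; apply: bigcup_open => i _.
exists psi; split=> //.
  by move=> j x; rewrite psiE => -[[]//|[/phiV]].
have : \forall nu \near (mu : wstar), forall j, prb mu (K j) - r < prb nu (O j).
  apply: (@filter_forall wstar J _ (nbhs (mu : wstar))) => j.
  apply: weak_star_open_lsc => //.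
  have : prb mu (K j) <= prb mu (O j).
    apply: prb_le => //; last exact: open_borel.
    by apply: closed_borel; have [] := KP j.
  by lra.
apply: filterS => nu nuO.
pose q := label_prb nu psi.
have qlo j : p j - 2 * r <= q j.
  have : prb nu (O j) <= q j.
    apply: prb_le; [exact: open_borel|exact: mpsi|].
    by move=> x; rewrite psiE; left.
  by have [_ _] := KP j; have := nuO j; lra.
(* Lower bounds suffice: both mass vectors have sum [1], so a fiber gains at most what the others
   lose. *)
have qup j : q j <= p j + del.
  have ps : \sum_i p i = 1 by exact: label_prb_sum.
  have qs : \sum_i q i = 1 by exact: label_prb_sum.
  have : \sum_(i | i != j) (p i - 2 * r) <= \sum_(i | i != j) q i.
    by apply: ler_sum => i _.
  rewrite sumrB; move: ps qs; rewrite (bigD1 j)//= [\sum_i q i](bigD1 j)//=.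
  have : \sum_(i | i != j) (2 * r) <= del.
    rewrite -rE mulr_natr sumr_const; apply: ler_wpMn2l; first lra.
    exact: max_card.
  lra.
have {}qup' j : `|q j - p j| <= del.
  rewrite ler_norml; apply/andP; split; last by have := qup j; lra.
  have : 2 * r <= del.
    rewrite -rE ler_peMr//; first lra.
    by rewrite ler1n; apply/card_gt0P; exists j.
  by have := qlo j; lra.
rewrite /label_entropy.
have -> : e = \sum_(j : J) e / #|J|%:R.
  by rewrite sumr_const -[RHS]mulr_natr divfK// gt_eqF.
rewrite -big_split /=; apply: ler_sum => j _.
have [_ dP] := dlP j; apply: dP; first exact: label_prb_ge0.
by apply: le_trans (qup' j) _.
Qed.

Lemma word_entropy_usc (T : X -> X) d (u : 'I_d -> set X) mu n (e : R) :
  continuous T -> (forall i, open (u i)) -> (forall x, exists i, u i x) -> 0 < e ->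
  \forall nu \near (mu : wstar), word_entropy T u nu n <= word_entropy T u mu n + e.
Proof.
move=> T_cont u_open u_cover e0; have e2 : 0 < e / 2 by lra.
have [J [phi [mphi fphi phie]]] := word_entropy_approx T_cont u_open u_cover mu n e2.
have /choice[w wP] := fphi.
have [|psi [mpsi psiV near_mu]] := @label_entropy_usc mu J phi (fun j => cylinder T u n (w j)) _ mphi _ wP e2.
  by move=> j; exact: cylinder_open.
apply: filterS near_mu => nu nuP.
have : word_entropy T u nu n <= label_entropy nu psi.
  by apply: word_entropy_le => // j; exists (w j).
lra.
Qed.

End UpperSemicontinuity.

(** * Empirical measures in the ergodic case *)

Section EmpiricalExpectation.
Context {R : realType} {X : pointedMetricType R}.
Hypothesis X_compact : compact [set: X].
Local Notation prob := (probability (borelType X) R).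
Local Notation wstar := (@weak_star R X).
Local Notation mble A := (measurable (A : set (borelType X))).
Implicit Types (mu nu : prob) (f g : X -> R).
Variable T : X -> X.

Definition dirac_prob (x : X) : prob := \d_(x : borelType X).

Lemma expect_dirac x f : continuous f -> expect (dirac_prob x) f = f x.
Proof.
move=> cf; rewrite /expect /Rintegral integral_dirac//.
  by rewrite diracT mul1e.
by apply/measurable_EFinP; exact: continuous_borel.
Qed.

Lemma prb_dirac x A : prb (dirac_prob x) A = (x \in A)%:R.
Proof. by []. Qed.

Lemma prb_empirical n x A : mble A ->
  prb (empirical T n x) A = n.+1%:R^-1 * \sum_(i < n.+1) prb (dirac_prob (iter i T x)) A.
Proof.
move=> mA; apply: EFin_inj; rewrite -prbE// EFinM -sumEFin.
rewrite /= /empirical /mscale /msum /=; congr (_ * _)%E.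
Qed.

Lemma expect_empirical n x f : continuous f ->
  expect (empirical T n x) f = n.+1%:R^-1 * \sum_(i < n.+1) f (iter i T x).
Proof.
move=> cf.
have [||mu [muE muf]] := @mixture_prob R X X_compact 'I_n.+1 (fun=> n.+1%:R^-1)
  (fun i => dirac_prob (iter i T x)).
- by [].
- by rewrite sumr_const card_ord -[LHS]mulr_natr mulVf.
transitivity (expect mu f).
  rewrite /expect /Rintegral; congr fine; apply: eq_measure_integral => A mA _.
  apply: etrans (prbE (empirical T n x) mA) _; apply: etrans _ (esym (prbE mu mA)).
  by congr (_%:E); rewrite prb_empirical// muE// mulr_sumr.
by rewrite muf// mulr_sumr; apply: eq_bigr => i _; rewrite expect_dirac.
Qed.

End EmpiricalExpectation.

(** * A weak law of large numbers for ergodic measures *)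

Section ErgodicAverages.
Context {R : realType} {X : pointedMetricType R}.
Hypothesis X_compact : compact [set: X].
Local Notation prob := (probability (borelType X) R).
Local Notation wstar := (@weak_star R X).
Local Notation mble A := (measurable (A : set (borelType X))).
Implicit Types (f g : X -> R).
Variables (T : X -> X) (mu : prob).
Hypothesis T_cont : continuous T.
Hypothesis mu_ergodic : ergodic_prob T mu.

Let mu_inv : invariant_prob T mu := mu_ergodic.1.

(** The continuous function [clamp (- h / C)] replaces the indicator of the complement of [A]: it
    vanishes on [A], is at most [1], and [h] is at least [- C] times it. *)
Lemma expect_ge_off h (A : set X) (C : R) : continuous h -> mble A -> 0 < C ->
  (forall x, - C <= h x) -> (forall x, A x -> 0 <= h x) ->
  - (C * (1 - prb mu A)) <= expect mu h.
Proof.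
move=> ch mA C0 hC hA; pose f x := clamp (- C^-1 * h x).
have cf : continuous f.
  move=> x; apply: (@continuous_comp _ _ _ (fun x => - C^-1 * h x) clamp).
    by apply: cvgM; [exact: cvg_cst|exact: ch].
  exact: clamp_continuous.
have : expect mu f <= prb mu (~` A).
  apply: expect_le_prb => //.
  - by move=> x; exact: clamp_itv.
  - exact: measurableC.
  - move=> x /contrapT /hA h0; rewrite /f /clamp max_l// ge_min.
    by rewrite mulNr oppr_le0 mulr_ge0 ?orbT// invr_ge0 ltW.
rewrite prb_setC// => fA.
have : expect mu (fun x => - C * f x) <= expect mu h.
  apply: expect_le => //.
    by move=> x; apply: cvgM; [exact: cvg_cst|exact: cf].
  move=> x; rewrite mulNr lerNl; have [h0|h0] := leP 0 (h x).
    by apply: (@le_trans _ _ 0); [lra|rewrite mulr_ge0// ?(ltW C0)//; case/andP: (clamp_itv (- C^-1 * h x))].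
  have : - C^-1 * h x <= f x.
    rewrite /f /clamp le_max le_min lexx andbT; apply/orP; right.
    by rewrite mulNr -mulrN mulrC ler_pdivrMr// mul1r; have := hC x; lra.
  rewrite -(ler_pM2l C0); apply: le_trans.
  by rewrite mulrA mulrN divff ?gt_eqF// mulN1r.
rewrite expectZ//; apply: le_trans.
by rewrite mulNr lerN2 ler_pM2l.
Qed.

Definition birkhoff_sum g n x : R := \sum_(i < n) g (iter i T x).

Lemma birkhoff_sumS g n x : birkhoff_sum g n.+1 x = g x + birkhoff_sum g n (T x).
Proof.
rewrite /birkhoff_sum big_ord_recl; congr (_ + _).
by apply: eq_bigr => i _; rewrite /= -iterS iterSr.
Qed.

Lemma birkhoff_sum_continuous g n : continuous g -> continuous (birkhoff_sum g n).
Proof.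
move=> cg x.
apply: (@cvg_sum_ord _ _ (nbhs x) (fun i x => g (iter i T x)) (fun i => g (iter i T x))) => i.
by apply: (@continuous_comp _ _ _ (iter i T) g); [exact: iter_continuous|exact: cg].
Qed.

(** This is the maximum of [birkhoff_sum g n x] over [0 <= n <= N], in the recursive form on which
    Garsia's argument rests. *)
Fixpoint maximal_sum g N x : R :=
  if N is N'.+1 then Num.max 0 (g x + maximal_sum g N' (T x)) else 0.

Lemma maximal_sum_continuous g N : continuous g -> continuous (maximal_sum g N).
Proof.
move=> cg; elim: N => [|N IH] x /=; first exact: cvg_cst.
apply: (@continuous_max R X (fun=> 0) (fun x => g x + maximal_sum g N (T x))).
  exact: cvg_cst.
apply: cvgD; first exact: cg.
by apply: (@continuous_comp _ _ _ T (maximal_sum g N)); [exact: T_cont|exact: IH].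
Qed.

Lemma maximal_sum_nondecreasing g N x : maximal_sum g N x <= maximal_sum g N.+1 x.
Proof.
elim: N x => [|N IH] x /=; first by rewrite le_max lexx.
by rewrite ge_max le_max lexx /= le_max lerD2l (IH (T x)) orbT.
Qed.

Lemma birkhoff_sum_le_maximal g N x : birkhoff_sum g N x <= maximal_sum g N x.
Proof.
elim: N x => [|N IH] x; first by rewrite /birkhoff_sum big_ord0.
by rewrite birkhoff_sumS /= le_max lerD2l IH orbT.
Qed.

(* Garsia's argument for the maximal ergodic inequality. *)
Lemma maximal_inequality g (C : R) N : continuous g -> 0 < C ->
  (forall x, `|g x| <= C) ->
  - (C * (1 - prb mu [set x | 0 < maximal_sum g N.+1 x])) <= expect mu g.
Proof.
move=> cg C0 gC; set A := [set x | _].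
have cM := @maximal_sum_continuous g N cg.
have cM' := @maximal_sum_continuous g N.+1 cg.
have cMT : continuous (maximal_sum g N \o T).
  by move=> x; apply: continuous_comp; [exact: T_cont|exact: cM].
have mA : mble A.
  apply: open_borel; apply: (@open_comp _ _ (maximal_sum g N.+1) [set y | 0 < y]).
    by move=> x _; exact: cM'.
  exact: open_gt.
(* On [A] the maximum in [maximal_sum] is its second argument, so [h] is [0]; off [A] it is at least
   [g]. By invariance and monotonicity in [N], the added difference has expectation at most [0]. *)
pose h x := g x + (maximal_sum g N (T x) + -1 * maximal_sum g N.+1 x).
have cNM : continuous (fun x => -1 * maximal_sum g N.+1 x).
  by move=> x; apply: cvgM; [exact: cvg_cst|exact: cM'].
have cNM2 : continuous (fun x => maximal_sum g N (T x) + -1 * maximal_sum g N.+1 x).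
  by move=> x; apply: cvgD; [exact: cMT|exact: cNM].
have ch : continuous h by move=> x; apply: cvgD; [exact: cg|exact: cNM2].
have M0 x : 0 <= maximal_sum g N x by case: (N) => //= k; rewrite le_max lexx.
have hA x : A x -> 0 <= h x.
  rewrite /A /h /= lt_max ltxx /= => h0; rewrite max_r; [lra|exact: ltW].
have hC x : - C <= h x.
  have := gC x; rewrite ler_norml => /andP[g1 g2].
  rewrite /h /=; have [gM|gM] := leP 0 (g x + maximal_sum g N (T x)).
    by lra.
  by have := M0 (T x); lra.
have := expect_ge_off ch mA C0 hC hA.
rewrite /h expectD// [in leRHS]expectD// expectZ//.
have -> : expect mu (fun x => maximal_sum g N (T x)) = expect mu (maximal_sum g N).
  apply: esym; apply: (@expect_pushforward R X X_compact mu mu T) => // B mB.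
  by rewrite mu_inv.
have : expect mu (maximal_sum g N) <= expect mu (maximal_sum g N.+1).
  by apply: expect_le => // x; exact: maximal_sum_nondecreasing.
lra.
Qed.

(** Sums along the orbits of [x] and [T x] differ by the bounded term [g x], so the set is strictly
    invariant and has mass [0] or [1]. In the second case the sets of the maximal inequality exhaust
    the space, and it gives [0 <= expect mu g]. *)
Lemma birkhoff_sum_bounded_above g : continuous g -> expect mu g < 0 ->
  prb mu [set x | forall K : nat, exists n, K%:R < birkhoff_sum g n x] = 0.
Proof.
move=> cg g0; set B := [set x | _].
have [C0 C00 gC0] := compact_continuous_bounded X_compact cg.
(* The bound is a natural number because the heights [K] are: passing between [x] and [T x] changes
   a height by at most [Cn]. *)
have [Cn CnP] : exists n : nat, C0 < n%:R.
  by exists (Num.bound C0); exact: archi_boundP.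
pose C : R := Cn%:R.
have gC x : `|g x| <= C by rewrite (le_trans (gC0 x))// ltW.
have Cp : 0 < C by exact: le_lt_trans CnP.
have BE : B = \bigcap_K \bigcup_n [set x | K%:R < birkhoff_sum g n x].
  apply/seteqP; split => x /= Bx K; first by have [n] := Bx K; exists n.
  by have [n _ h] := Bx K I; exists n.
have mB : mble B.
  rewrite BE; apply: bigcapT_measurable => K; apply: open_borel.
  apply: bigcup_open => n _.
  apply: (@open_comp _ _ (birkhoff_sum g n) [set y | K%:R < y]); last exact: open_gt.
  by move=> x _; exact: birkhoff_sum_continuous.
have TB : T @^-1` B = B.
  apply/seteqP; split => x /= Bx K.
    have [n] := Bx (K + Cn)%N; rewrite natrD => h; exists n.+1.
    rewrite birkhoff_sumS; have := gC x; rewrite ler_norml => /andP[g1 g2].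
    by rewrite -/C in h; lra.
  have [[|n]] := Bx (K + Cn)%N.
    by rewrite /birkhoff_sum big_ord0 ltrn0.
  rewrite birkhoff_sumS natrD => h; exists n.
  have := gC x; rewrite ler_norml => /andP[g1 g2].
  by rewrite -/C in h; lra.
have [B0|B1] := mu_ergodic.2 B mB TB; first by rewrite /prb B0.
suff : 0 <= expect mu g by lra.
apply/ler_addgt0Pr => e e0.
pose A N := [set x | 0 < maximal_sum g N x].
have mA N : mble (A N).
  apply: open_borel; apply: (@open_comp _ _ (maximal_sum g N) [set y | 0 < y]).
    by move=> x _; exact: maximal_sum_continuous.
  exact: open_gt.
have AS N : A N `<=` A N.+1.
  by move=> x /= h; exact: lt_le_trans h (maximal_sum_nondecreasing g N x).
have BA : B `<=` \bigcup_N A N.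
  move=> x Bx; have [n h] := Bx 0%N; exists n => //=.
  by apply: lt_le_trans (birkhoff_sum_le_maximal g n x).
have eC : 0 < e / C by rewrite divr_gt0.
have [N NP] := prb_bigcup_lt mu mA AS eC.
have U1 : 1 <= prb mu (\bigcup_N A N).
  have <- : prb mu B = 1 by rewrite /prb B1.
  by apply: prb_le => //; exact: bigcupT_measurable.
have h1 : prb mu (A N) <= prb mu (A N.+1) by exact: prb_le.
have := @maximal_inequality g C N cg Cp gC.
have : C * (1 - prb mu (A N.+1)) <= e.
  by rewrite mulrC -ler_pdivlMr//; lra.
rewrite -/(A N.+1); lra.
Qed.

(** Subtracting a constant halfway between the mean and the threshold makes the mean negative, so a
    height [K] is exceeded at some time only with probability below [e]. A deviation at time [n]
    means a sum of at least [n dl / 2], which is above [K] for large [n]. *)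
Lemma birkhoff_sum_deviation f (dl e : R) : continuous f -> 0 < dl -> 0 < e ->
  \forall n \near \oo,
    prb mu [set x | n%:R * (expect mu f + dl) <= birkhoff_sum f n x] < e.
Proof.
move=> cf dl0 e0; pose c : R := expect mu f + dl / 2.
pose g x := f x + - c.
have cg : continuous g by move=> x; apply: cvgD; [exact: cf|exact: cvg_cst].
have g0 : expect mu g < 0.
  by rewrite expectD ?expect_cst /c//; [lra|exact: cst_continuous].
pose D (K : nat) := \bigcup_n [set x | K%:R < birkhoff_sum g n x].
have Do K : open (D K).
  apply: bigcup_open => n _.
  apply: (@open_comp _ _ (birkhoff_sum g n) [set y | K%:R < y]); last exact: open_gt.
  by move=> x _; exact: birkhoff_sum_continuous.
have DS K : D K.+1 `<=` D K.
  move=> x [n _ /= h]; exists n => //=; apply: lt_trans h.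
  by rewrite ltr_nat.
have D0 : prb mu (\bigcap_K D K) = 0.
  rewrite -[RHS](birkhoff_sum_bounded_above cg g0); congr prb.
  apply/seteqP; split => x /= Bx K; last by have [n] := Bx K; exists n.
  by have [n _ h] := Bx K I; exists n.
have [K KP] := prb_bigcap_lt (fun K => open_borel (Do K)) DS D0 e0.
near=> n; apply: le_lt_trans KP; apply: prb_le => //; last 1 first.
- move=> x /= h; exists n => //=.
  have -> : birkhoff_sum g n x = birkhoff_sum f n x - n%:R * c.
    by rewrite /birkhoff_sum /g big_split /= sumr_const card_ord mulNrn mulr_natl.
  apply: (@lt_le_trans _ _ (n%:R * (dl / 2))); last first.
    by rewrite lerBrDr; apply: le_trans h; rewrite /c -mulrDr; apply: ler_wpM2l => //; lra.
  rewrite -ltr_pdivrMr; last lra.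
  by near: n; exact: nbhs_infty_gtr.
- apply: closed_borel.
  apply: (@closed_comp _ _ (birkhoff_sum f n) [set y | n%:R * (expect mu f + dl) <= y]) => //.
  by move=> x _; exact: birkhoff_sum_continuous.
- exact: open_borel.
Unshelve. all: by end_near. Qed.

Lemma empirical_expect_deviation f (dl e : R) : continuous f -> 0 < dl -> 0 < e ->
  \forall n \near \oo, exists G : set X, [/\ mble G, 1 - e < prb mu G &
    forall x, G x -> `|expect (empirical T n x) f - expect mu f| <= dl].
Proof.
move=> cf dl0 e0; have e2 : 0 < e / 2 by lra.
have cNf : continuous (fun x => -1 * f x).
  by move=> x; apply: cvgM; [exact: cvg_cst|exact: cf].
have := birkhoff_sum_deviation cf dl0 e2; have := birkhoff_sum_deviation cNf dl0 e2.
move=> [N1 _ H1] [N2 _ H2]; exists (N1 + N2)%N => // n /= nN.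
(* [empirical T n] averages over [n + 1] points. *)
have {}H1 := H1 n.+1 ltac:(rewrite /=; lia).
have {}H2 := H2 n.+1 ltac:(rewrite /=; lia).
move: H1 H2; rewrite /= expectZ//; set A1 := [set x | _]; set A2 := [set x | _] => H1 H2.
have mA1 : mble A1.
  apply: closed_borel.
  apply: (@closed_comp _ _ (birkhoff_sum (fun x => -1 * f x) n.+1)
    [set y | n.+1%:R * (-1 * expect mu f + dl) <= y]) => //.
  by move=> x _; exact: birkhoff_sum_continuous.
have mA2 : mble A2.
  apply: closed_borel.
  apply: (@closed_comp _ _ (birkhoff_sum f n.+1) [set y | n.+1%:R * (expect mu f + dl) <= y]) => //.
  by move=> x _; exact: birkhoff_sum_continuous.
exists (~` (A1 `|` A2)); split.
- by apply: measurableC; exact: measurableU.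
- rewrite prb_setC; last exact: measurableU.
  have := prb_setUle mu mA1 mA2; lra.
- move=> x /not_orP[/= /negP + /negP]; rewrite -!ltNge => h1 h2.
  rewrite expect_empirical//; have n0 : 0 < n.+1%:R :> R by [].
  have h1' : birkhoff_sum (fun x => -1 * f x) n.+1 x = - birkhoff_sum f n.+1 x.
    by rewrite /birkhoff_sum -sumrN; apply: eq_bigr => i _; rewrite mulN1r.
  rewrite -/(birkhoff_sum f n.+1 x) ler_norml; apply/andP; split.
    rewrite lerBrDr ler_pdivlMl//; move: h1; rewrite h1'.
    have -> : n.+1%:R * (-1 * expect mu f + dl) = - (n.+1%:R * (- dl + expect mu f)) by ring.
    by rewrite ltrN2 => /ltW.
  by rewrite lerBlDr ler_pdivrMl// addrC ltW.
Qed.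

(** A neighbourhood involves finitely many test functions, so finitely many deviation estimates
    suffice; the induction on their number halves [e] at each step. *)
Lemma empirical_near_ergodic (B : set prob) (e : R) : nbhs (mu : wstar) B -> 0 < e ->
  \forall n \near \oo, exists G : set X, [/\ mble G, 1 - e < prb mu G &
    forall x, G x -> B (empirical T n x : prob)].
Proof.
move=> /weak_star_nbhs[k [fs [dl [dl0 BP]]]] e0.
suff : \forall n \near \oo, exists G : set X, [/\ mble G, 1 - e < prb mu G &
    forall x i, G x -> (i < k)%N ->
      `|expect (empirical T n x) (fs i) - expect mu (fs i)| <= dl].
  apply: filterS => n [G [mG eG Gx]]; exists G; split=> // x xG.
  by apply: BP => i ik; exact: Gx.
elim: k e e0 {BP} => [|k IH] e e0.
  near=> n; exists setT; split=> //; rewrite prb_setT; lra.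
have e2 : 0 < e / 2 by lra.
have ck : continuous (fs k) by exact: cts_fun.
have := IH _ e2; have := empirical_expect_deviation ck dl0 e2.
apply: filterS2 => n [G [mG eG Gx]] [G' [mG' eG' Gx']].
exists (~` (~` G `|` ~` G')); split.
- by apply: measurableC; apply: measurableU; exact: measurableC.
- rewrite prb_setC; last by apply: measurableU; exact: measurableC.
  have := prb_setUle mu (measurableC mG) (measurableC mG').
  by rewrite !prb_setC//; lra.
- move=> x i /not_orP[/contrapT xG /contrapT xG'].
  by rewrite ltnS leq_eqVlt => /orP[/eqP ->|ik]; [exact: Gx|exact: Gx'].
Unshelve. all: by end_near. Qed.

End ErgodicAverages.

(** * The lower bound *)

Section LimitInferiorBounds.
Context {R : realType}.
Local Open Scope ereal_scope.
Implicit Types (v : (\bar R)^nat) (c : \bar R).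

Lemma limn_esup_le v c : (\forall n \near \oo, v n <= c) -> limn_esup v <= c.
Proof.
move=> vc; rewrite /limn_esup limf_esupE; apply: ge_ereal_inf.
exists (ereal_sup (v @` [set n | v n <= c])); first by exists [set n | v n <= c].
by apply: ge_ereal_sup => _ [n nc <-].
Qed.

Lemma le_limn_einf v c : (\forall n \near \oo, c <= v n) -> c <= limn_einf v.
Proof.
move=> vc; rewrite /limn_einf leeNr; apply: limn_esup_le.
by apply: filterS vc => n; rewrite leeN2.
Qed.

End LimitInferiorBounds.

Section PressureBounds.
Context {R : realType} {X : pointedMetricType R}.
Hypothesis X_compact : compact [set: X].
Variables (T : X -> X) (d : nat) (u : 'I_d -> set X).
Hypothesis T_cont : continuous T.
Hypothesis u_open : forall i, open (u i).
Hypothesis u_cover : forall x, exists i, u i x.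
Local Notation prob := (probability (borelType X) R).
Local Notation wstar := (@weak_star R X).
Local Notation mble A := (measurable (A : set (borelType X))).
Implicit Types (mu nu : prob).
Variable E : prob -> R.
Hypothesis E_energy : energy E.

Let p n := pressure_sum T E (range u) n.

Definition energy_weight n (V : set X) : R :=
  sup [set expR (n.+1%:R * E (empirical T n x)) | x in V].

Lemma energy_bounded : exists2 M, 0 <= M & forall nu : prob, `|E nu| <= M.
Proof.
have /compact_bounded[M [_ MP]] : compact ((E : wstar -> R) @` [set: wstar]).
  apply: continuous_compact; last exact: weak_star_compact.
  exact: continuous_subspaceT.
exists (`|M| + 1); first by rewrite addr_ge0.
move=> nu; apply: (MP (`|M| + 1)); last by exists nu.
by rewrite (le_lt_trans (ler_norm _))// ltrDl.
Qed.

Lemma energy_weight_ge n (V : set X) x : V x ->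
  expR (n.+1%:R * E (empirical T n x)) <= energy_weight n V.
Proof.
move=> Vx; have [M M0 EM] := energy_bounded.
apply: ub_le_sup; last by exists x.
exists (expR (n.+1%:R * M)) => _ [y _ <-].
by rewrite ler_expR ler_wpM2l// (le_trans (ler_norm _)).
Qed.

Lemma energy_weight0 n : energy_weight n set0 = 0.
Proof. by rewrite /energy_weight image_set0 sup0. Qed.

Lemma energy_weight_ge0 n (V : set X) : 0 <= energy_weight n V.
Proof.
have [[x Vx]|V0] := pselect (V !=set0).
  by apply: le_trans (energy_weight_ge n Vx); exact: expR_ge0.
by rewrite (_ : V = set0) ?energy_weight0//; apply/seteqP; split => // x Vx; case: V0; exists x.
Qed.

Lemma energy_weight_le n (V : set X) (c : R) :
  (forall x, V x -> E (empirical T n x) <= c) ->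
  energy_weight n V <= expR (n.+1%:R * c).
Proof.
move=> Vc; have [[x Vx]|V0] := pselect (V !=set0).
  apply: ge_sup; first by exists (expR (n.+1%:R * E (empirical T n x))), x.
  by move=> _ [y Vy <-]; rewrite ler_expR ler_wpM2l//; exact: Vc.
rewrite (_ : V = set0) ?energy_weight0 ?expR_ge0//.
by apply/seteqP; split => // x Vx; case: V0; exists x.
Qed.

Lemma pressure_sum_ge n (c : R) :
  (forall k (F : 'I_k -> set X), (forall i, mble (F i)) -> (forall x, exists i, F i x) ->
     (forall i, exists w, F i `<=` cylinder T u n.+1 w) ->
     c <= \sum_i energy_weight n (F i)) -> c <= p n.
Proof.
move=> h; have [J [phi [mphi fphi _]]] := word_label T_cont u_open u_cover n.+1.
apply: lb_le_inf.
  pose alpha := range (fun j => phi @^-1` [set j]).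
  eexists; exists alpha; last by [].
  split; last exact: fibers_finer.
  by have [] := fibers_partition mphi.
move=> _ [C [[Cf Cm CT] Cfine] <-].
have [k [F [_ CF sumF]]] := finite_set_enum Cf.
rewrite sumF; apply: h.
- by move=> i; apply: Cm; rewrite CF; exists i.
- move=> x; have : (\bigcup_(V in C) V) x by rewrite CT.
  by rewrite CF => -[_ [i _ <-] Fx]; exists i.
- move=> i; have [|W WI FW] := Cfine (F i); first by rewrite CF; exists i.
  by move: WI; rewrite iter_cover_cylinder// => -[w _ wW]; exists w; rewrite wW.
Qed.

Lemma pressure_sum_le n (I : finType) (F : I -> set X) :
  (forall i, mble (F i)) -> (forall x, exists i, F i x) ->
  (forall i, exists w, F i `<=` cylinder T u n.+1 w) ->
  p n <= \sum_i energy_weight n (F i).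
Proof.
move=> mF Fcov Ffine.
apply: le_trans (sum_range_le (fun i => energy_weight_ge0 n (F i))).
apply: ge_inf.
  exists 0 => _ [C [[Cf _ _] _] <-]; have [k [G [_ _ ->]]] := finite_set_enum Cf.
  by apply: sumr_ge0 => i _; exact: energy_weight_ge0.
exists (range F) => //; split; first split.
- exact: finite_image.
- by move=> _ [i _ <-].
- apply/seteqP; split => // x _; have [i Fx] := Fcov x.
  by exists (F i) => //; exists i.
- move=> _ [i _ <-]; have [w Fw] := Ffine i.
  by exists (cylinder T u n.+1 w) => //; rewrite iter_cover_cylinder//; exists w.
Qed.

(** Label the points of [G] by the first element of the cover containing them, which has its index
    in [S], and the other points by one of [d^n] words. *)
Lemma word_entropy_le_count nu n k (F : 'I_k -> set X) (G : set X) (S : {set 'I_k}) :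
  (forall i, mble (F i)) -> (forall x, exists i, F i x) ->
  (forall i, exists w, F i `<=` cylinder T u n w) -> mble G ->
  (forall i x, G x -> F i x -> i \in S) -> (0 < #|S|)%N ->
  word_entropy T u nu n <= ln 2 + ln #|S|%:R + (1 - prb nu G) * (n%:R * ln d%:R).
Proof.
move=> mF Fcov Ffine mG GS S0.
have [phi mphi phiF] := first_index_label mF Fcov.
have [J [psi [mpsi fpsi cJ]]] := word_label T_cont u_open u_cover n.
pose chi x : 'I_k + J := if `[< G x >] then inl (phi x) else inr (psi x).
have chil i : chi @^-1` [set inl i] = G `&` phi @^-1` [set i].
  apply/seteqP; split => x; rewrite /chi /=.
    by case: asboolP => // Gx [<-].
  by move=> [Gx <-]; rewrite asboolT.
have chir j : chi @^-1` [set inr j] = ~` G `&` psi @^-1` [set j].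
  apply/seteqP; split => x; rewrite /chi /=.
    by case: asboolP => // Gx [<-].
  by move=> [Gx <-]; rewrite asboolF.
have mchi : measurable_label chi.
  move=> [i|j]; rewrite ?chil ?chir; first exact: measurableI.
  by apply: measurableI => //; exact: measurableC.
have fchi : fine_label T u n chi.
  move=> [i|j]; rewrite ?chil ?chir.
    have [w Fw] := Ffine i; exists w => x [_ /= xi]; apply: Fw.
    by rewrite -xi.
  by have [w pw] := fpsi j; exists w => x [_ /pw].
apply: le_trans (word_entropy_le u_cover nu mchi fchi) _.
have d0 : (0 < d)%N by have [i _] := u_cover point; case: d i => // -[].
have J0 : 0 < #|J|%:R :> R by rewrite cJ ltr0n expn_gt0 d0.
have s0 : 0 < #|S|%:R :> R by rewrite ltr0n.
(* Half of the mass is uniform on [S] and half uniform on the words; the halving is the origin of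
   [ln 2]. *)
pose q (s : 'I_k + J) : R := match s with
  | inl i => if i \in S then (2 * #|S|%:R)^-1 else 0
  | inr j => (2 * #|J|%:R)^-1 end.
have pS i : i \notin S -> label_prb nu chi (inl i) = 0.
  move=> iS; rewrite /label_prb chil (_ : _ `&` _ = set0) ?prb_set0//.
  apply/seteqP; split => // x [Gx /= xi]; move/negP: iS; apply.
  by apply: (GS _ x) => //; rewrite -xi.
have hg := @label_entropy_gibbs R X nu _ chi q mchi.
apply: le_trans (hg _ _ _) _.
- by move=> [i|j] /=; rewrite ?invr_ge0 ?mulr_ge0//; case: ifP => // _; rewrite invr_ge0 mulr_ge0.
- rewrite big_sumType /= -big_mkcond /= !sumr_const -[X in X + _]mulr_natr -[X in _ + X]mulr_natr.
  rewrite !invfM -!mulrA !mulVf ?gt_eqF// mulr1; lra.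
- move=> [i|j] /=; last by move/eqP; rewrite invr_eq0 gt_eqF// mulr_gt0.
  by case: ifPn => [_ /eqP|iS _]; [rewrite invr_eq0 gt_eqF// mulr_gt0|exact: pS].
rewrite big_sumType /=.
have -> : \sum_i - (label_prb nu chi (inl i) * ln (if i \in S then (2 * #|S|%:R)^-1 else 0)) =
    prb nu G * (ln 2 + ln #|S|%:R).
  rewrite -(prb_fibers nu mphi mG) mulr_suml; apply: eq_bigr => i _.
  rewrite /label_prb chil; case: ifPn => iS; first by rewrite lnV ?lnM ?posrE ?mulr_gt0// mulrN opprK.
  by rewrite -chil [prb _ _](pS _ iS) !mul0r oppr0.
have -> : \sum_j - (label_prb nu chi (inr j) * ln (2 * #|J|%:R)^-1) =
    (1 - prb nu G) * (ln 2 + n%:R * ln d%:R).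
  rewrite -prb_setC// -(prb_fibers nu mpsi (measurableC mG)) mulr_suml.
  apply: eq_bigr => j _; rewrite /label_prb chir lnV ?lnM ?posrE ?mulr_gt0// mulrN opprK.
  by rewrite cJ natrX lnXn ?ltr0n// mulr_natl.
have lS : 0 <= ln (#|S|%:R : R) by rewrite ln_ge0// ler1n.
have := prb_le1 nu mG; have := prb_ge0 nu G => g0 g1.
have : prb nu G * ln #|S|%:R <= ln #|S|%:R by rewrite ler_piMl.
lra.
Qed.

(** Only the cover elements meeting [G] are kept. Each weighs at least [expR ((n + 1) a)], and
    entropy bounds their number from below. *)
Lemma pressure_sum_lower nu n (G : set X) (a : R) : mble G -> 0 < prb nu G ->
  (forall x, G x -> a <= E (empirical T n x)) ->
  expR (n.+1%:R * a + word_entropy T u nu n.+1 - ln 2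
    - (1 - prb nu G) * (n.+1%:R * ln d%:R)) <= p n.
Proof.
move=> mG G0 Ga; apply: pressure_sum_ge => k F mF Fcov Ffine.
pose S := [set i | `[< exists2 x, G x & F i x >]]%SET.
have GS i x : G x -> F i x -> i \in S.
  by move=> Gx Fx; rewrite inE; apply/asboolP; exists x.
have S0 : (0 < #|S|)%N.
  have [x Gx] : G !=set0.
    by apply/set0P/negP => /eqP G_eq; move: G0; rewrite G_eq prb_set0 ltxx.
  by have [i Fx] := Fcov x; apply/card_gt0P; exists i; exact: GS Fx.
have h := word_entropy_le_count nu mF Fcov Ffine mG GS S0.
have s0 : 0 < #|S|%:R :> R by rewrite ltr0n.
apply: (@le_trans _ _ (expR (n.+1%:R * a) * #|S|%:R)).
  by rewrite -[#|S|%:R]lnK ?posrE// -expRD ler_expR; lra.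
rewrite mulr_natr -sumr_const [leRHS](bigID (mem S))/=.
apply: (@le_trans _ _ (\sum_(i in S) energy_weight n (F i))); last first.
  by rewrite lerDl; apply: sumr_ge0 => i _; exact: energy_weight_ge0.
apply: ler_sum => i; rewrite inE => /asboolP[x Gx Fx].
apply: le_trans (energy_weight_ge n Fx).
by rewrite ler_expR ler_wpM2l//; exact: Ga.
Qed.

Lemma pressure_sum_gt0 n : 0 < p n.
Proof.
have [M M0 EM] := energy_bounded.
have := @pressure_sum_lower (dirac_prob point) n setT (- M) measurableT.
rewrite prb_setT => /(_ ltr01) h.
apply: lt_le_trans (h _) => [|x _]; first exact: expR_gt0.
by have := EM (empirical T n x); rewrite ler_norml => /andP[].
Qed.

Theorem lower_pressure_ge_ergodic nu : ergodic_prob T nu ->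
  ((entropy T (range u) nu + E nu)%:E <= lower_pressure T E (range u))%E.
Proof.
move=> nu_erg; apply/lee_addgt0Pr => e e0.
have lnd : 0 <= ln (d%:R : R).
  have d0 : (0 < d)%N by have [i _] := u_cover point; case: d i => // -[].
  by rewrite ln_ge0// ler1n.
(* Four errors of [e / 4] occur: the energy, the limit defining the entropy, [ln 2 / (n + 1)], and
   the mass off [G] times [ln d]. The bound [r <= 1] makes the mass of [G] positive. *)
pose r := Num.min 1 (e / 4 / (1 + ln d%:R)).
have r0 : 0 < r by rewrite lt_min ltr01 !divr_gt0//; lra.
have rd : r * ln d%:R <= e / 4.
  apply: (@le_trans _ _ (r * (1 + ln d%:R))); first by rewrite ler_wpM2l ?ltW//; lra.
  by rewrite -ler_pdivlMr; [rewrite ge_min lexx orbT|lra].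
rewrite -leeBlDr// -EFinB; apply: le_limn_einf.
have E_near : nbhs (nu : wstar) [set rho | E nu - e / 4 < E rho].
  apply: (@cvgr_gt _ wstar (nbhs (nu : wstar)) _ (E : wstar -> R) (E nu)).
    exact: E_energy.
  lra.
have near_G := empirical_near_ergodic X_compact T_cont nu_erg E_near r0.
have near_h : \forall n \near \oo, entropy T (range u) nu - e / 4 <
    n%:R^-1 * word_entropy T u nu n.
  apply: (cvgr_gt _ (entropy_cvg T_cont u_open u_cover nu_erg.1)); lra.
have [N _ NP] := near_h.
near=> n.
have [G [mG rG Gx]] : exists G : set X, [/\ mble G, 1 - r < prb nu G &
    forall x, G x -> [set rho | E nu - e / 4 < E rho] (empirical T n x : prob)].
  by near: n.
have G0 : 0 < prb nu G.
  by apply: le_lt_trans rG; rewrite subr_ge0 ge_min lexx.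
have n0 : 0 < n.+1%:R :> R by [].
have hn : entropy T (range u) nu - e / 4 < n.+1%:R^-1 * word_entropy T u nu n.+1.
  by apply: NP => /=; near: n; exists N => // m /= Nm; lia.
have ln2n : n.+1%:R^-1 * ln 2 <= e / 4.
  rewrite ler_pdivrMl// -ler_pdivrMr; last lra.
  near: n; have [K _ KP] := @nbhs_infty_ger R (ln 2 / (e / 4)).
  by exists K => // m /= Km; apply: (KP m.+1) => /=; lia.
rewrite lne_EFin ?pressure_sum_gt0// -EFinM lee_fin ler_pdivlMl//.
have := pressure_sum_lower mG G0 (fun x xG => ltW (Gx x xG)).
rewrite -ler_ln ?posrE ?expR_gt0 ?pressure_sum_gt0// expRK; apply: le_trans.
rewrite -ler_pdivlMl//.
have -> : n.+1%:R^-1 * (n.+1%:R * (E nu - e / 4) + word_entropy T u nu n.+1 - ln 2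
    - (1 - prb nu G) * (n.+1%:R * ln d%:R)) =
  (E nu - e / 4) + n.+1%:R^-1 * word_entropy T u nu n.+1 - n.+1%:R^-1 * ln 2
    - (1 - prb nu G) * ln d%:R.
  by field; rewrite gt_eqF.
have : (1 - prb nu G) * ln d%:R <= e / 4.
  by apply: (le_trans _ rd); rewrite ler_wpM2r//; lra.
move: hn ln2n; move: (_ * word_entropy _ _ _ _) (_ * ln 2) (_ * ln d%:R) => x y z.
lra.
Unshelve. all: by end_near. Qed.

End PressureBounds.

(** * The upper bound *)

Section PackingMeasures.
Context {R : realType} {X : pointedMetricType R}.
Variables (T : X -> X) (d : nat) (u : 'I_d -> set X).
Hypothesis u_cover : forall x, exists i, u i x.

(** Membership in cylinders depends only on the type [tau x], the sets of letters allowed at the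
    times below [n]. So [greedy_packing] applies to the finite set [Q] of types, and the number of
    types gives the bound [1 + n d ln 2]. The prices add up to [k], hence the division by [k], and
    the case [k = 0] is that of an empty [Y]. *)
Lemma cylinder_packing n (Y : set X) : exists k (v : 'I_k -> nat -> 'I_d),
  (forall x, Y x -> exists i, cylinder T u n (v i) x) /\
  ((0 < k)%N -> exists (Q : finType) (w : Q -> R) (r : Q -> X),
    [/\ forall q, 0 <= w q, \sum_q w q = 1, forall q, w q != 0 -> Y (r q) &
      forall v', \sum_(q | `[< cylinder T u n v' (r q) >]) w q <=
        (1 + n%:R * d%:R * ln 2) / k%:R]).
Proof.
have [d0 _] := u_cover point.
pose Q : finType := {ffun 'I_n -> {set 'I_d}}.
pose tau x : Q := [ffun i : 'I_n => [set a | `[< u a (iter i T x) >]]%SET].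
pose W : finType := {ffun 'I_n -> 'I_d}.
pose V (w : W) : {set Q} := [set q : Q | [forall i, w i \in q i]]%SET.
pose restr (v : nat -> 'I_d) : W := [ffun i : 'I_n => v i].
(* Letters beyond [n] are irrelevant to cylinders of length [n]; they are set to [d0]. *)
pose ext (w : W) (i : nat) : 'I_d := if insub i is Some j then w j else d0.
have restrK w : restr (ext w) = w.
  by apply/ffunP => i; rewrite ffunE /ext valK.
have VP v x : (tau x \in V (restr v)) = `[< cylinder T u n v x >].
  rewrite inE; apply/forallP/asboolP.
    move=> h i il; have := h (Ordinal il); rewrite !ffunE inE => /asboolP.
    exact.
  by move=> h i; rewrite !ffunE inE; apply/asboolP; exact: h.
pose S : {set Q} := [set q | `[< exists2 x, Y x & tau x = q >]]%SET.
have [q|s [y [ys y0 yS ysum yV]]] := @greedy_packing R Q W V S.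
  rewrite inE => /asboolP[x Yx <-].
  have /choice[v vP] i : exists a, u a (iter i T x) by exact: u_cover.
  by exists (restr v); rewrite VP; apply/asboolP => i _; exact: vP.
pose k := size s; exists k, (fun i => ext (tnth (in_tuple s) i)); split.
  move=> x Yx; have [|w ws xw] := ys (tau x).
    by rewrite inE; apply/asboolP; exists x.
  have /tnthP[i wi] : w \in in_tuple s by [].
  by exists i; apply/asboolP; rewrite -VP restrK -wi.
move=> k0; have kR : 0 < k%:R :> R by rewrite ltr0n.
(* [r] picks a point of [Y] of each type in [S]; the other types have weight [0]. *)
have /choice[r rP] q : exists x, q \in S -> Y x /\ tau x = q.
  have [|qS] := boolP (q \in S); last by exists point.
  by rewrite inE => /asboolP[x Yx xq]; exists x.
exists Q, (fun q => y q / k%:R), r; split.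
- by move=> q; rewrite divr_ge0.
- by rewrite -mulr_suml ysum divff// gt_eqF.
- move=> q; have [qS _|qS] := boolP (q \in S); first by have [] := rP q qS.
  by rewrite yS// mul0r eqxx.
move=> v'; rewrite -mulr_suml ler_pM2r ?invr_gt0//.
apply: (@le_trans _ _ (\sum_(q in V (restr v')) y q)).
  rewrite big_mkcond [leRHS]big_mkcond /=; apply: ler_sum => q _.
  have [qS|qS] := boolP (q \in S); last by rewrite yS// !if_same.
  have [_ rq] := rP q qS; have := VP v' (r q); rewrite rq => ->.
  by case: ifP.
apply: le_trans (yV _) _.
have Qc : #|Q| = (2 ^ (d * n))%N.
  by rewrite card_ffun card_ord -[#|{set 'I_d}|]cardsT -powersetT card_powerset cardsT card_ord expnM.
apply: (@le_trans _ _ (harmonic_bound #|Q|)).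
  exact/harmonic_bound_le/max_card.
rewrite Qc; have : (0 < 2 ^ (d * n))%N by rewrite expn_gt0.
case E : (2 ^ (d * n))%N => [//|N] _ /=; rewrite -E natrX lnXn ?ltr0n//.
by rewrite lerD2l -natrM mulr_natl mulnC.
Qed.

End PackingMeasures.

(** * Convex classes of measures with nearly constant energy *)

Section EnergyClasses.
Context {R : realType} {X : pointedMetricType R}.
Hypothesis X_compact : compact [set: X].
Local Notation prob := (probability (borelType X) R).
Local Notation wstar := (@weak_star R X).
Local Notation mble A := (measurable (A : set (borelType X))).
Variables (T : X -> X) (E : prob -> R).
Hypothesis T_cont : continuous T.
Hypothesis E_energy : energy E.

(* As [E] is not affine, an average of measures with nearby energies is
   controlled only when these measures lie in a common small convex set. *)
Lemma energy_classes (e : R) : 0 < e -> exists L (a : 'I_L -> R) (W : 'I_L -> set prob),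
  [/\ forall nu, exists c, W c nu,
    forall c n, mble [set x | W c (empirical T n x : prob)] &
    forall c (I : finType) (w : I -> R) (p : I -> prob) mu,
      (forall i, 0 <= w i) -> \sum_i w i = 1 ->
      (forall f, continuous f -> expect mu f = \sum_i w i * expect (p i) f) ->
      (forall i, w i != 0 -> W c (p i)) -> `|E mu - a c| <= e].
Proof.
move=> e0.
have /choice[D DP] (nu : prob) : exists D : nat * (nat -> continuousType X R) * R,
    0 < D.2 /\ forall rho : prob,
      (forall i, (i < D.1.1)%N -> `|expect rho (D.1.2 i) - expect nu (D.1.2 i)| <= D.2) ->
      `|E rho - E nu| <= e.
  have Enu : nbhs (nu : wstar) [set rho | `|E rho - E nu| <= e].
    have cE : continuous (E : wstar -> R) := E_energy.
    move: (cE nu) => /cvgrPdist_le /(_ e e0).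
    by apply: filterS => rho; rewrite distrC.
  by have [n [fs [dl [dl0 H]]]] := weak_star_nbhs Enu; exists (n, fs, dl).
(* Conditions on expectations are convex, so mixtures of elements of [W nu] still satisfy the bounds
   required by [DP]. The strict inequality makes the sets of points with empirical measure in [W nu]
   open, hence measurable. *)
pose W (nu : prob) : set prob := [set rho | forall i, (i < (D nu).1.1)%N ->
  `|expect rho ((D nu).1.2 i) - expect nu ((D nu).1.2 i)| < (D nu).2].
have Wnbhs (nu : wstar) : nbhs nu (W nu).
  have [dl0 _] := DP nu.
  rewrite /W; move: (D nu) dl0 => [[n fs] dl] /= dl0.
  elim: n => [|n IH]; first by apply: (@filterS wstar (nbhs nu) _ setT) => [rho _ i //|]; exact: filterT.
  have /cvgrPdist_lt /(_ dl dl0) /= H := @expect_continuous R X (fs n) nu.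
  apply: (@filterS2 wstar (nbhs nu) _ _ _ _ _ IH H) => rho h hn i; rewrite ltnS leq_eqVlt => /orP[/eqP ->|il].
    by rewrite distrC.
  exact: h.
have := @weak_star_compact R X X_compact; rewrite compact_cover.
move=> /(_ wstar setT (fun nu => interior (W nu : set wstar))).
case.
- by move=> nu _; exact: open_interior.
- by move=> nu _; exists nu => //; exact: Wnbhs.
move=> F _ Fcov; pose s := finmap.enum_fset F.
exists (size s), (fun c => E (tnth (in_tuple s) c)), (fun c => W (tnth (in_tuple s) c)).
split.
- move=> nu; have [rho rhoF] := Fcov nu I => /interior_subset Wnu.
  have /tnthP[c cE] : rho \in in_tuple s by [].
  by exists c; rewrite -cE.
- move=> c n; move: (tnth _ _) => nu; rewrite /W /=.
  move: (D nu) => [[k fs] dl] /=.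
  rewrite (_ : [set x | _] = \bigcap_i [set x | (i < k)%N ->
      `|expect (empirical T n x : prob) (fs i) - expect nu (fs i)| < dl]); last first.
    apply/seteqP; split => x /= h i; first by move=> _; exact: h.
    exact: h.
  apply: bigcapT_measurable => i; have [ik|ik] := ltnP i k; last first.
    by rewrite (_ : [set x | _] = setT) //; apply/seteqP; split.
  have cfi : continuous (fs i) by exact: cts_fun.
  pose g x := n.+1%:R^-1 * birkhoff_sum T (fs i) n.+1 x - expect nu (fs i).
  have cg : continuous g.
    move=> x; apply: cvgB; last exact: cvg_cst.
    by apply: cvgM; [exact: cvg_cst|exact: birkhoff_sum_continuous].
  rewrite (_ : [set x | _] = g @^-1` [set y | `|y| < dl]).
    apply: open_borel; apply: open_comp; first by move=> x _; exact: cg.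
    rewrite (_ : [set y | _] = `]- dl, dl[%classic); first exact: interval_open.
    by apply/seteqP; split => y; rewrite /= in_itv /= ltr_norml.
  have gE x : expect (empirical T n x) (fs i) - expect nu (fs i) = g x.
    by rewrite (expect_empirical X_compact T n x cfi).
  by apply/seteqP; split => x /=; rewrite -gE; [apply|move=> h].
- move=> c J w p mu w0 w1 muE Wp; move: (tnth _ _) Wp => nu Wp.
  have [_ DE] := DP nu; apply: DE => i il.
  have cfi : continuous ((D nu).1.2 i) by exact: cts_fun.
  rewrite muE//.
  have -> : expect nu ((D nu).1.2 i) = \sum_j w j * expect nu ((D nu).1.2 i).
    by rewrite -mulr_suml w1 mul1r.
  rewrite -sumrB; apply: le_trans (ler_norm_sum _ _ _) _.
  rewrite -[leRHS]mul1r -w1 mulr_suml; apply: ler_sum => j _.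
  rewrite -mulrBr normrM ger0_norm//.
  have [->|wj] := eqVneq (w j) 0; first by rewrite !mul0r.
  by rewrite ler_wpM2l// ltW//; exact: Wp.
Qed.

End EnergyClasses.

Section UpperBound.
Context {R : realType} {X : pointedMetricType R}.
Hypothesis X_compact : compact [set: X].
Variables (T : X -> X) (d : nat) (u : 'I_d -> set X).
Hypothesis T_cont : continuous T.
Hypothesis u_open : forall i, open (u i).
Hypothesis u_cover : forall x, exists i, u i x.
Local Notation prob := (probability (borelType X) R).
Local Notation wstar := (@weak_star R X).
Local Notation mble A := (measurable (A : set (borelType X))).
Implicit Types (mu nu : prob).
Variable E : prob -> R.
Hypothesis E_energy : energy E.

Let p n := pressure_sum T E (range u) n.

(** With [s] the square root of the argument, [ln (s^2) <= 2 s]. Squaring [2 s <= N e] for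
    [N = n + 1] leaves [4 (1 + N D) <= N^2 e^2], which follows from [4 + 4 D <= N e^2] and
    [1 <= N]. *)
Lemma log_affine_small (D e : R) : 0 <= D -> 0 < e ->
  \forall n \near \oo, ln (1 + n.+1%:R * D) <= n.+1%:R * e.
Proof.
move=> D0 e0; near=> n.
have n0 : 0 < n.+1%:R :> R by [].
have y0 : 0 < 1 + n.+1%:R * D by rewrite ltr_wpDr// mulr_ge0.
pose s := Num.sqrt (1 + n.+1%:R * D).
have s0 : 0 < s by rewrite sqrtr_gt0.
have sE : 1 + n.+1%:R * D = s ^+ 2 by rewrite sqr_sqrtr// ltW.
rewrite sE lnXn// -[ln s *+ 2]mulr_natl.
apply: (@le_trans _ _ (2 * s)); first by rewrite ler_pM2l// ltW// ln_sublinear.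
have nbig : (4 + 4 * D) / e ^+ 2 <= n.+1%:R.
  apply: (@le_trans _ _ n%:R); last by rewrite ler_nat.
  by near: n; exact: nbhs_infty_ger.
rewrite ler_pdivrMr ?exprn_gt0// in nbig.
have s2 : 0 <= 2 * s by rewrite mulr_ge0// ltW.
have ne0 : 0 <= n.+1%:R * e by rewrite mulr_ge0// ltW.
rewrite -(@ler_pXn2r _ 2)// exprMn -sE exprMn.
have n1 : 1 <= n.+1%:R :> R by rewrite ler1n.
have := ler_wpM2l (ltW n0) nbig; move: n.+1%:R n1 => N n1 nb.
have : 4 * 1 <= 4 * N by rewrite ler_pM2l.
move: nb; rewrite mulrDr !mulrA => nb h4.
apply: le_trans nb.
have -> : 2 ^+ 2 * (1 + N * D) = 4 + N * 4 * D by ring.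
lra.
Unshelve. all: by end_near. Qed.

(** [mu] is used in two ways: as a mixture of empirical measures, which later controls its energy
    and its near-invariance, and as a time average of pushforwards of the packing measure, to which
    block splitting and concavity of entropy apply. *)
Lemma packing_entropy (n : nat) (Q : finType) (w : Q -> R) (r : Q -> X) (k : nat) :
  (forall q, 0 <= w q) -> \sum_q w q = 1 -> (0 < k)%N ->
  (forall v, \sum_(q | `[< cylinder T u n.+1 v (r q) >]) w q <=
     (1 + n.+1%:R * d%:R * ln 2) / k%:R) ->
  exists mu : prob,
    [/\ forall f, continuous f -> expect mu f = \sum_q w q * expect (empirical T n (r q)) f &
        forall N, (0 < N)%N ->
          N%:R * (ln k%:R - ln (1 + n.+1%:R * d%:R * ln 2)) <=
          n.+1%:R * word_entropy T u mu N + N%:R ^+ 2 * ln d%:R].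
Proof.
move=> w0 w1 k0 pack.
have kR : 0 < k%:R :> R by rewrite ltr0n.
have ln20 : 0 <= ln 2 :> R by rewrite ln_ge0// ler1n.
have t0 : 0 < 1 + n.+1%:R * d%:R * ln 2 :> R.
  by rewrite ltr_wpDr// !mulr_ge0.
(* [sg m] is the law of [T^m] applied to a random point with weights [w]: [sg 0] is the packing
   measure, and [mu] is the average of [sg 0, ..., sg n]. *)
have /choice[sg sgP] m : exists rho : prob, forall A, mble A ->
    prb rho A = \sum_q w q * prb (dirac_prob (iter m T (r q))) A.
  have [rho [H _]] := mixture_prob X_compact (fun q => dirac_prob (iter m T (r q))) w0 w1.
  by exists rho.
have [mu [muE muf]] := mixture_prob X_compact (fun q => (empirical T n (r q) : prob)) w0 w1.
exists mu; split => // N N0.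
have sg_shift i l A : mble A -> sg (i + l)%N A = sg i (iter l T @^-1` A).
  move=> mA; have mTA : mble (iter l T @^-1` A).
    by apply: preimage_borel => //; exact: iter_continuous.
  rewrite (prbE (sg (i + l)%N) mA) (prbE (sg i) mTA); congr (_%:E).
  rewrite !sgP//; apply: eq_bigr => q _; congr (_ * _).
  by rewrite !prb_dirac addnC iterD.
have low : ln k%:R - ln (1 + n.+1%:R * d%:R * ln 2) <= word_entropy T u (sg 0%N) n.+1.
  have := @word_entropy_lower R X T d u T_cont u_open u_cover (sg 0%N) n.+1
    ((1 + n.+1%:R * d%:R * ln 2) / k%:R).
  rewrite divr_gt0// ln_div ?posrE// opprB; apply => // v.
  have mv : mble (cylinder T u n.+1 v) by apply: open_borel; exact: cylinder_open.
  apply: le_trans (pack v); rewrite sgP// [leRHS]big_mkcond /=.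
  apply: ler_sum => q _; rewrite prb_dirac.
  case: asboolP => h; first by rewrite mem_set//= mulr1.
  by rewrite memNset//= mulr0.
have conc : \sum_(i < n.+1) n.+1%:R^-1 * word_entropy T u (sg i) N <= word_entropy T u mu N.
  apply: (@word_entropy_concave R X T d u T_cont u_open u_cover 'I_n.+1
    (fun=> n.+1%:R^-1) (fun i => sg i)).
  - by move=> i.
  - by rewrite sumr_const card_ord -[LHS]mulr_natr mulVf.
  move=> A mA; rewrite muE//.
  under eq_bigr do rewrite prb_empirical// mulr_sumr mulr_sumr.
  rewrite exchange_big /=; apply: eq_bigr => i _; rewrite sgP// mulr_sumr.
  by apply: eq_bigr => q _; rewrite mulrCA.
have blocks := @word_entropy_blocks R X T d u T_cont u_open u_cover sg n.+1 N N0 sg_shift.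
apply: (@le_trans _ _ (N%:R * word_entropy T u (sg 0%N) n.+1)).
  by rewrite ler_wpM2l.
apply: le_trans blocks _; rewrite lerD2r.
by rewrite -ler_pdivrMl// mulr_sumr.
Qed.

(** Among the [L] energy classes, the one contributing most to the cover carries at least the
    fraction [1 / L] of the bound for [p n]. In [2 * e], one [e] leads from the points of the class
    to [a c], the other from [a c] to [E mu]. Near-invariance comes from telescoping along
    orbits. *)
Lemma pressure_measure (e : R) : 0 < e -> exists2 L : nat, (0 < L)%N &
  forall n, exists mu : prob,
    (forall N, (0 < N)%N ->
      N%:R * (ln (p n) - ln L%:R - n.+1%:R * (E mu + 2 * e)
        - ln (1 + n.+1%:R * d%:R * ln 2)) <=
      n.+1%:R * word_entropy T u mu N + N%:R ^+ 2 * ln d%:R) /\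
    (forall f M, continuous f -> (forall x, `|f x| <= M) ->
      `|expect mu (f \o T) - expect mu f| <= 2 * M / n.+1%:R).
Proof.
move=> e0; have [L [a [W [Wcov mW Wconv]]]] := energy_classes X_compact T_cont E_energy e0.
have [c0 _] := Wcov (dirac_prob point).
have L0 : (0 < L)%N by case: (L) c0 => // -[].
exists L => // n.
pose Y c := [set x | W c (empirical T n x : prob)].
(* A single measure is a mixture indexed by [unit]. *)
have Ea c x : Y c x -> E (empirical T n x) <= a c + e.
  move=> Yx; have := @Wconv c unit (fun=> 1) (fun=> (empirical T n x : prob)) (empirical T n x).
  move=> /(_ _ _ _ _)/wrap[]//.
  - by rewrite sumr_const card_unit.
  - by move=> f cf; rewrite sumr_const card_unit mul1r.
  - by rewrite ler_norml => /andP[_]; lra.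
have /choice[kv kvP] c : exists kv : {k : nat & 'I_k -> nat -> 'I_d},
    (forall x, Y c x -> exists i, cylinder T u n.+1 (projT2 kv i) x) /\
    ((0 < projT1 kv)%N -> exists (Q : finType) (w : Q -> R) (r : Q -> X),
    [/\ forall q, 0 <= w q, \sum_q w q = 1, forall q, w q != 0 -> Y c (r q) &
      forall v', \sum_(q | `[< cylinder T u n.+1 v' (r q) >]) w q <=
        (1 + n.+1%:R * d%:R * ln 2) / (projT1 kv)%:R]).
  by have [k [v H]] := cylinder_packing T u_cover n.+1 (Y c); exists (existT _ k v).
pose t c := (projT1 (kv c))%:R * expR (n.+1%:R * (a c + e)).
have pt : p n <= \sum_c t c.
  have := @pressure_sum_le R X X_compact T d u u_cover E E_energy n
    {c : 'I_L & 'I_(projT1 (kv c))}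
    (fun ci => cylinder T u n.+1 (projT2 (kv (tag ci)) (tagged ci)) `&` Y (tag ci)).
  move=> /(_ _ _ _)/wrap[].
  - move=> [c i] /=; apply: measurableI; last exact: mW.
    by apply: open_borel; exact: cylinder_open.
  - move=> x; have [c Wx] := Wcov (empirical T n x).
    have [i xi] := (kvP c).1 x Wx.
    by exists (existT _ c i).
  - by move=> [c i] /=; exists (projT2 (kv c) i) => x [].
  move=> h; apply: le_trans h _.
  rewrite -(@sig_big_dep _ _ _ _ _ xpredT (fun _ => xpredT) (fun c i =>
    energy_weight T E n (cylinder T u n.+1 (projT2 (kv c) i) `&` Y c)))/=.
  apply: ler_sum => c _.
  apply: (@le_trans _ _ (\sum_(i < projT1 (kv c)) expR (n.+1%:R * (a c + e)))).
    by apply: ler_sum => i _; apply: energy_weight_le => x [_ /Ea].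
  by rewrite sumr_const card_ord /t -[leLHS]mulr_natl.
have [c _ cmax] := @arg_maxP _ _ _ c0 xpredT t isT.
have ptc : p n <= L%:R * t c.
  apply: le_trans pt _; rewrite -[L in L%:R](card_ord L) mulr_natl -sumr_const.
  by apply: ler_sum => i _; exact: cmax.
have pn0 : 0 < p n by exact: pressure_sum_gt0.
(* If the best class used no cylinder, [p n] would be at most [0]. *)
have k0 : (0 < projT1 (kv c))%N.
  rewrite lt0n; apply/eqP => k_eq; move: ptc.
  by rewrite /t k_eq mul0r mulr0 leNgt pn0.
have [Q [w [r [w0 w1 wY pack]]]] := (kvP c).2 k0.
have [mu [muf muN]] := packing_entropy w0 w1 k0 pack.
exists mu; split.
  move=> N N0; apply: le_trans (muN N N0); rewrite ler_wpM2l// lerD2r.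
  have Emu : `|E mu - a c| <= e.
    by apply: (Wconv c Q w (fun q => (empirical T n (r q) : prob))).
  have kR : 0 < (projT1 (kv c))%:R :> R by rewrite ltr0n.
  have LR : 0 < L%:R :> R by rewrite ltr0n.
  move: ptc; rewrite -ler_ln ?posrE ?mulr_gt0 ?expR_gt0//.
  rewrite lnM ?posrE ?mulr_gt0 ?expR_gt0// lnM ?posrE ?expR_gt0// expRK => h.
  have : n.+1%:R * (a c + e) <= n.+1%:R * (E mu + 2 * e).
    by rewrite ler_wpM2l//; move: Emu; rewrite ler_norml => /andP[]; lra.
  lra.
move=> f M cf fM.
have cfT : continuous (f \o T) by move=> x; apply: continuous_comp; [exact: T_cont|exact: cf].
rewrite muf// muf// -sumrB.
apply: le_trans (ler_norm_sum _ _ _) _.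
have -> : 2 * M / n.+1%:R = \sum_q w q * (2 * M / n.+1%:R).
  by rewrite -mulr_suml w1 mul1r.
apply: ler_sum => q _.
rewrite -mulrBr normrM ger0_norm// ler_wpM2l// !(expect_empirical X_compact)//.
rewrite -mulrBr normrM ger0_norm ?invr_ge0// [leRHS]mulrC ler_wpM2l ?invr_ge0//.
rewrite -sumrB.
have -> : \sum_(i < n.+1) ((f \o T) (iter i T (r q)) - f (iter i T (r q))) =
    f (iter n.+1 T (r q)) - f (r q).
  rewrite -(big_mkord xpredT (fun i => f (iter i.+1 T (r q)) - f (iter i T (r q)))).
  by rewrite (telescope_sumr (fun i => f (iter i T (r q)))).
have := fM (iter n.+1 T (r q)); have := fM (r q).
by rewrite !ler_norml => /andP[? ?] /andP[? ?]; apply/andP; split; lra.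
Qed.

(** The measure is a cluster point of the measures of [pressure_measure] along those [n] for which
    [p n] is large. The block length [N] is fixed before [n], so the boundary term [N ln d] is
    absorbed; the limit in [N] is taken only at the end, for the invariant cluster point. *)
Lemma exists_invariant_prob (r r' : R) : r' < r ->
  ~ (\forall n \near \oo, ln (p n) <= n.+1%:R * r) ->
  exists2 mu, invariant_prob T mu & r' <= entropy T (range u) mu + E mu.
Proof.
(* The seven errors: two in [pressure_measure], one for the continuity of [E], one for
   semicontinuity of entropy, and one each for [ln L], for the packing loss and for [N ln d]. *)
move=> rr' often; pose e := (r - r') / 7.
have e0 : 0 < e by rewrite divr_gt0// subr_gt0.
have [L L0 /choice[m mP]] := pressure_measure e0.
have lnd : 0 <= ln (d%:R : R).
  have d0 : (0 < d)%N by have [i _] := u_cover point; case: d i => // -[].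
  by rewrite ln_ge0// ler1n.
pose often_set := [set n | n.+1%:R * r < ln (p n)].
pose F := m @ within often_set \oo.
have oftenP (A : set nat) : (\forall n \near \oo, A n) -> exists2 n, often_set n & A n.
  move=> nA; apply: contrapT => nex; apply: often.
  apply: filterS nA => n An; rewrite leNgt; apply/negP => h.
  by apply: nex; exists n.
have FF : ProperFilter F.
  split.
    move=> F0; have [n nS nA] := oftenP _ F0.
    exact: nA nS.
  exact: fmap_filter.
have [mu [_ mu_cl]] : [set: wstar] `&` cluster (F : set_system wstar) !=set0.
  by apply: (@weak_star_compact R X X_compact F FF); exact: filterT.
have pick (A : set nat) (B : set prob) : (\forall n \near \oo, A n) -> nbhs (mu : wstar) B ->
    exists n, [/\ often_set n, A n & B (m n)].
  move=> nA nB.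
  (* [F] is a filter on measures and forgets the indices; this set recovers an index from a measure
     near [mu]. *)
  have FA : F [set nu | exists n, [/\ often_set n, A n & nu = m n]].
    apply: filterS nA => n An nS; exists n.
    by split.
  have [nu [[n [nS An ->]] Bn]] := mu_cl _ _ FA nB.
  by exists n.
have mu_inv : invariant_prob T mu.
  apply: invariant_prob_expect => // f cf.
  have cfT : continuous (f \o T) by move=> x; apply: continuous_comp; [exact: T_cont|exact: cf].
  have [M M0 fM] := compact_continuous_bounded X_compact cf.
  apply/eqP; rewrite -subr_eq0 -normr_le0; apply/ler_addgt0Pr => eta eta0; rewrite add0r.
  have eta3 : 0 < eta / 3 by lra.
  have n1 : nbhs (mu : wstar) [set nu | `|expect mu f - expect nu f| <= eta / 3].
    by have /cvgrPdist_le /(_ _ eta3) := @expect_continuous R X (mkcts cf) mu.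
  have n2 : nbhs (mu : wstar) [set nu | `|expect mu (f \o T) - expect nu (f \o T)| <= eta / 3].
    by have /cvgrPdist_le /(_ _ eta3) := @expect_continuous R X (mkcts cfT) mu.
  have n3 : \forall n \near \oo, 2 * M / n.+1%:R <= eta / 3.
    near=> n; rewrite ler_pdivrMr// -ler_pdivrMl//.
    apply: (@le_trans _ _ n%:R); last by rewrite ler_nat.
    by near: n; exact: nbhs_infty_ger.
  have [n [_ /= h3 [h1 h2]]] := pick _ _ n3 (filterI n1 n2).
  have := le_trans ((mP n).2 f M cf fM) h3.
  move: h1 h2; rewrite /= !ler_norml => /andP[? ?] /andP[? ?] /andP[? ?].
  by apply/andP; split; lra.
exists mu => //.
have bound N : (0 < N)%N -> r' <= N%:R^-1 * word_entropy T u mu N + E mu.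
  move=> N0; have NR : 0 < N%:R :> R by rewrite ltr0n.
  have N1 : 1 <= N%:R :> R by rewrite ler1n.
  have n1 : nbhs (mu : wstar) [set nu | E nu <= E mu + e].
    have cE : continuous (E : wstar -> R) := E_energy.
    move: (cE mu) => /cvgrPdist_le /(_ e e0).
    by apply: filterS => nu; rewrite /= ler_norml => /andP[]; lra.
  have n2 := @word_entropy_usc R X X_compact T d u mu N e T_cont u_open u_cover e0.
  have ln2D : 0 <= d%:R * ln 2 :> R by rewrite mulr_ge0// ln_ge0// ler1n.
  have n3 := log_affine_small ln2D e0.
  have n4 : \forall n \near \oo, ln L%:R <= n.+1%:R * e.
    near=> n; rewrite -ler_pdivrMr//.
    apply: (@le_trans _ _ n%:R); last by rewrite ler_nat.
    by near: n; exact: nbhs_infty_ger.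
  have n5 : \forall n \near \oo, N%:R * ln d%:R <= n.+1%:R * e.
    near=> n; rewrite -ler_pdivrMr//.
    apply: (@le_trans _ _ n%:R); last by rewrite ler_nat.
    by near: n; exact: nbhs_infty_ger.
  have [n [/= nS [[h3 h4] h5] [h1 h2]]] :=
    pick _ _ (filterI (filterI n3 n4) n5) (filterI n1 n2).
  have n0 : 0 < n.+1%:R :> R by [].
  have := (mP n).1 N N0; rewrite /= in h1 h2 h3 h4 h5.
  rewrite -ler_pdivlMl// -mulrA.
  have -> : N%:R^-1 * (n.+1%:R * word_entropy T u (m n) N + N%:R ^+ 2 * ln d%:R) =
      n.+1%:R * (N%:R^-1 * word_entropy T u (m n) N) + N%:R * ln d%:R.
    by field; rewrite gt_eqF.
  have hN : N%:R^-1 * word_entropy T u (m n) N <= N%:R^-1 * word_entropy T u mu N + e.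
    rewrite ler_pdivrMl// mulrDr mulrA divff ?gt_eqF// mul1r.
    by apply: (le_trans h2); rewrite lerD2l ler_peMl// ltW.
  have hN' : n.+1%:R * (N%:R^-1 * word_entropy T u (m n) N) <=
      n.+1%:R * (N%:R^-1 * word_entropy T u mu N + e) by rewrite ler_wpM2l.
  have h1' : n.+1%:R * (E (m n) + 2 * e) <= n.+1%:R * (E mu + 3 * e).
    by rewrite ler_wpM2l//; lra.
  move=> main; rewrite -(ler_pM2l n0).
  have rE : r' = r - 7 * e by rewrite /e; field.
  rewrite rE; move: nS; rewrite /often_set /=.
  move: main hN' h1' h3 h4 h5; rewrite !mulrDr !mulrN.
  move: (N%:R^-1 * _) => x.
  lra.
have h := entropy_cvg T_cont u_open u_cover mu_inv.
rewrite -lerBlDr.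
apply: (cvgr_to_ge h).
near=> n; rewrite lerBlDr; apply: bound.
by near: n; exact: nbhs_infty_gt.
Unshelve. all: by end_near. Qed.

Theorem pressure_le_variational :
  (pressure T E (range u) <=
   ereal_sup [set (entropy T (range u) mu + E mu)%:E | mu in invariant_prob T])%E.
Proof.
set S := ereal_sup _.
(* If [ln (p n)] exceeded [(n + 1) r] infinitely often, some invariant measure would reach [r'],
   above the supremum. *)
have above (r r' : R) : r' < r -> (S < r'%:E)%E -> (pressure T E (range u) <= r%:E)%E.
  move=> rr' Sr'; apply: limn_esup_le.
  have [nr|often] := pselect (\forall n \near \oo, ln (p n) <= n.+1%:R * r).
    apply: filterS nr => n nr; rewrite lne_EFin; last exact: pressure_sum_gt0.
    by rewrite -EFinM lee_fin ler_pdivrMl.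
  have [mu mu_inv r'le] := exists_invariant_prob rr' often.
  have : ((entropy T (range u) mu + E mu)%:E <= S)%E.
    by apply: ereal_sup_ubound; exists mu.
  by move=> /le_lt_trans /(_ Sr'); rewrite lte_fin ltNge r'le.
case SE : S => [s| |]; last 2 first.
- by rewrite leey.
(* When the supremum is [-oo], [above] applies to every real [r], so the pressure is [-oo] too. *)
- have below r : (pressure T E (range u) <= r%:E)%E.
    by apply: (above r (r - 1)); [lra|rewrite SE ltNyr].
  case: (pressure T E (range u)) below => [q| |] // below.
    by have := below (q - 1)%R; rewrite lee_fin lerBrDr gerDl ler10.
  by have := below 0%R; rewrite leye_eq.
- apply/lee_addgt0Pr => e e0; rewrite -EFinD.
  by apply: (above (s + e) (s + e / 2)); [lra|rewrite SE lte_fin; lra].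
Qed.

End UpperBound.

Theorem theorem1p3 (R : realType) (X : pointedMetricType R)
    (X_compact : compact [set: X])
    (T : X -> X) (T_cont : continuous T)
    (T_surj : set_surj [set: X] [set: X] T)
    (E : probability (borelType X) R -> R) (E_energy : energy E)
    (U : set (set X)) (U_open_cover : is_open_cover U)
    (abundance : ergodic_abundance T E U) :
  pressure T E U = lower_pressure T E U /\
  lower_pressure T E U =
    ereal_sup [set (entropy T U mu + E mu)%:E | mu in invariant_prob T].
Proof.
have [[U_fin _ U_cov] U_open] := U_open_cover.
have [d [u [_ UE _]]] := finite_set_enum (R := R) U_fin.
have u_open i : open (u i) by apply: U_open; rewrite UE; exists i.
have u_cover x : exists i, u i x.
  have : (\bigcup_(V in U) V) x by rewrite U_cov.
  by rewrite UE => -[_ [i _ <-] ux]; exists i.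
have up : (pressure T E U <=
    ereal_sup [set (entropy T U mu + E mu)%:E | mu in invariant_prob T])%E.
  by rewrite UE; exact: pressure_le_variational.
have low : (ereal_sup [set (entropy T U mu + E mu)%:E | mu in invariant_prob T] <=
    lower_pressure T E U)%E.
  apply: ge_ereal_sup => _ [mu mu_inv <-]; apply/lee_addgt0Pr => e e0.
  have [nu nu_erg nu_mu] := abundance mu mu_inv e e0.
  have : ((entropy T U nu + E nu)%:E <= lower_pressure T E U)%E.
    by rewrite UE; exact: lower_pressure_ge_ergodic.
  by move=> /(leeD2r e%:E); apply: le_trans; rewrite -EFinD lee_fin; lra.
have mid : (lower_pressure T E U <= pressure T E U)%E by exact: limn_einf_sup.
split; apply/eqP; rewrite eq_le.
  by rewrite (le_trans up low) mid.
by rewrite (le_trans mid up) low.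
Qed.
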